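(* There exist $d\in\mathbb{N}$, a permutation $\sigma$ on $d$ symbols, a uniquely ergodic self-similar interval exchange transformation $\mathcal{IE}_0$, and a (nondegenerate) line segment $\ell\subset\mathbb{R}^d_+$ such that $\mathcal{IE}_0=\mathcal{IE}_\sigma(\mathbf{a}_0)$ with $\mathbf{a}_0$ in the interior of $\ell$, and such that for all $\mathbf{a}\in\ell\smallsetminus\{\mathbf{a}_0\}$ the interval exchange transformation $\mathcal{IE}_\sigma(\mathbf{a})$ is periodic.
   Context: $\mathbb{R}^d_+$ denotes the set of vectors in $\mathbb{R}^d$ with all entries positive. For a permutation $\sigma$ on $d$ symbols and $\mathbf{a}=(a_1,\dots,a_d)\in\mathbb{R}^d_+$, $\mathcal{IE}_\sigma(\mathbf{a}):I\to I$ is the interval exchange transformation obtained by partitioning $I=[0,\sum a_i)$ into consecutive subintervals of lengths $a_1,\dots,a_d$ and permuting them by translations according to $\sigma$. It is uniquely ergodic if Lebesgue measure is, up to scaling, its only invariant measure. It is periodic if every point of $I$ is periodic. It is self-similar if there is a proper subinterval $J\subsetneq I$ such that the first return map to $J$ is a rescaling of it, i.e. there is $c\in(0,1)$ with $|J|=c|I|$ and the first return map to $J$ is (up to translating $J$ to start at $0$) $\mathcal{IE}_\sigma(c\,\mathbf{a})$. *)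

(* Defs.v *)
From HB Require Import structures.
From mathcomp Require Import all_boot all_order all_algebra all_fingroup.
From mathcomp Require Import all_classical all_reals all_analysis.

Set Implicit Arguments.
Unset Strict Implicit.
Unset Printing Implicit Defensive.

Import Order.TTheory GRing.Theory Num.Theory.
Import numFieldNormedType.Exports.

Local Open Scope classical_set_scope.
Local Open Scope ring_scope.

Section Interval_exchange.
Variables (R : realType) (d : nat).
Implicit Types (s : 'S_d) (a p q : 'rV[R]_d) (i j : 'I_d) (x y : R).

Definition positive_vector a : Prop := forall i, 0 < a 0 i.

Definition total_length a : R := \sum_(i < d) a 0 i.

Definition iet_dom a : set R := `[0, total_length a[%classic.

Definition left_end a i : R := \sum_(j < d | (j < i)%N) a 0 j.

(* [s] sends the [i]-th interval to the [s i]-th position, so that exactly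
   the intervals [j] with [s j < s i] lie to its left after the exchange. *)
Definition new_left_end s a i : R := \sum_(j < d | (s j < s i)%N) a 0 j.

(* At most one [i] contributes to the sum; as a total function on [R] the
   exchange is the identity outside [iet_dom a]. *)
Definition iet s a x : R :=
  x + \sum_(i < d | left_end a i <= x < left_end a i + a 0 i)
        (new_left_end s a i - left_end a i).

End Interval_exchange.

Definition invariant_on (R : realType) (D : set R) (T : R -> R)
    (mu : set (measurableTypeR R) -> \bar R) : Prop :=
  forall A : set (measurableTypeR R), measurable A -> A `<=` D ->
    mu (D `&` T @^-1` A) = mu A.

(* A finite Borel measure on [iet_dom a] is represented by any finite Borel
   measure on [R] extending it: only subsets of [iet_dom a] are measured.
   Without finiteness the notion would be void, since counting measure on an
   infinite orbit is invariant. *)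
Definition uniquely_ergodic (R : realType) d (s : 'S_d) (a : 'rV[R]_d) : Prop :=
  invariant_on (iet_dom a) (iet s a) (@lebesgue_measure R) /\
  forall mu : {finite_measure set (measurableTypeR R) -> \bar R},
    invariant_on (iet_dom a) (iet s a) mu ->
    exists2 c : R, 0 <= c &
      forall A : set (measurableTypeR R), measurable A -> A `<=` iet_dom a ->
        mu A = (c%:E * lebesgue_measure A)%E.

Definition periodic_iet (R : realType) d (s : 'S_d) (a : 'rV[R]_d) : Prop :=
  forall x, iet_dom a x -> exists2 n, (0 < n)%N & iter n (iet s a) x = x.

Definition first_return (X : Type) (T : X -> X) (J : set X) (x y : X) : Prop :=
  exists n, [/\ (0 < n)%N, iter n T x = y, J y &
    forall m, (0 < m < n)%N -> ~ J (iter m T x)].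

Definition self_similar (R : realType) d (s : 'S_d) (a : 'rV[R]_d) : Prop :=
  exists c u : R, let J := `[u, u + c * total_length a[%classic in
    [/\ 0 < c < 1, J `<` iet_dom a &
      forall x, J x ->
        first_return (iet s a) J x (u + iet s (c *: a) (x - u))].

Definition segment (R : realType) d (p q : 'rV[R]_d) : set 'rV[R]_d :=
  [set (1 - t) *: p + t *: q | t in `[0, 1]%classic].

Definition open_segment (R : realType) d (p q : 'rV[R]_d) : set 'rV[R]_d :=
  [set (1 - t) *: p + t *: q | t in `]0, 1[%classic].

(* Main.v *)
Require Import Defs.
From HB Require Import structures.
From mathcomp Require Import all_boot all_order all_algebra all_fingroup.
From mathcomp Require Import all_classical all_reals all_analysis.
From mathcomp Require Import measurable_realfun.
From mathcomp Require Import ring lra.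

Set Implicit Arguments.
Unset Strict Implicit.
Unset Printing Implicit Defensive.

Import Order.TTheory GRing.Theory Num.Theory.
Local Open Scope classical_set_scope.
Local Open Scope ring_scope.

(** The example is the Arnoux-Yoccoz interval exchange and its relative
    deformation.  Let a be the real root of a^3 + a^2 + a = 1 and b = a^2.  For
    a small real d, cut [0, 2) at
      0, a^3 - d, 1 - a, 1 - b, 1 + a - b - d, 1 + a, 1 + a + b - d, 2
    and translate the seven pieces by
      a + b, 1 + a, a - 1, 1 - a, b - 1, - b - 1, - a - b.
    For |d| <= a^3 this is an interval exchange T_d with a permutation sigma that
    does not depend on d, and the lengths are affine in d, so that d in
    [-1/16, 1/16] describes a segment in the space of lengths, whose midpoint is
    T_0.

    Everything rests on one renormalization: with E y = (a - b) + b y, the first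
    return map of T_{b d} to the interval E [0, 2) is E o T_d o E^-1
    (first_return_base).  Its return words do not depend on d.

    - Self-similarity of T_0 is the case d = 0.
    - Periodicity for d != 0: dividing d by b repeatedly, one reaches a parameter
      with a^5 <= |d| <= a^3 (periodic_family).  There T_d is visibly periodic:
      [0, 2) is tiled by the levels of four towers, each of which is mapped back
      to its base by the identity (periodic_far).  If T_d is periodic then so is
      T_{b d}, since the towers over E [0, 2) fill [0, 2) (periodic_lift).
    - Unique ergodicity of T_0: let F x = mu [0, x) for an invariant finite
      measure mu.  The increments of F are invariant along the pieces, and
      F (E y) - F (E 0) has the same property (renorm_invariant).  The masses of
      the seven pieces therefore lie in the images of the nonnegative cone by
      all powers of the incidence matrix of the return words; this matrix is
      primitive, so the masses are proportional to the lengths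
      (incidence_orbit_proportional).  The deviation of F from a linear function
      is then the same at z as the deviation of the renormalized function at some
      other point, and the latter is bounded by a multiple of a slope that is
      multiplied by b < 1 at each renormalization: F is linear (invariant_linear), and mu is a multiple of
      Lebesgue measure.

    All endpoints involved are integer combinations of 1, a, b, d.  The
    combinatorial facts about towers are stated for such formal combinations,
    decided there by computation, and transported to the reals by evaluation. *)

(** * Towers over a piecewise translation *)

(** Cut points [c] and translation amounts [t] describe a map sending [x] to
    [x + t`_i] for [x] between [c`_i] and [c`_i.+1].  The notions below make sense
    in any abelian group, with an arbitrary relation [le] in place of the order,
    and are used both for real numbers and for formal linear combinations. *)
Section Towers.
Context {V : zmodType}.
Implicit Types (c t : seq V) (l r x y : V) (w : seq nat) (le : rel V).

(** The total translation along an itinerary [w], a list of piece indices. *)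
Definition drift t w : V := foldr (fun i v => t`_i + v) 0 w.

(** The interval from [l] to [r] follows the itinerary [w]: its successive
    translates lie in the pieces listed in [w]. *)
Fixpoint carried le c t l r w : bool :=
  if w is i :: w' then
    [&& (i < size t)%N, le c`_i l, le r c`_i.+1
      & carried le c t (l + t`_i) (r + t`_i) w']
  else true.

(** A base interval from [low] to [high] with an itinerary. *)
Record tower := Tower { low : V; high : V; route : seq nat }.

(** The base of [C] follows the itinerary of [C]. *)
Definition climbs le c t (C : tower) : bool :=
  carried le c t (low C) (high C) (route C).

(** The end points of the [k]-th translate of the base along the itinerary. *)
Definition level t (C : tower) k : V * V :=
  (low C + drift t (take k (route C)), high C + drift t (take k (route C))).

(** [s] lists consecutive intervals, the first starting at [x] and the last
    ending at [y]. *)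
Fixpoint chain x (s : seq (V * V)) y : bool :=
  if s is p :: s' then (p.1 == x) && chain p.2 s' y else x == y.

(** The levels listed in [s], where [(i, k)] stands for level [k] of [Cs i]. *)
Definition levels t (Cs : nat -> tower) (s : seq (nat * nat)) : seq (V * V) :=
  [seq level t (Cs p.1) p.2 | p <- s].

End Towers.
Arguments tower : clear implicits.

Section TowersMorphism.
Context {V W : zmodType} (f : {additive V -> W}).

Definition map_tower (C : tower V) : tower W :=
  Tower (f (low C)) (f (high C)) (route C).

Lemma nth_map_raddf (t : seq V) i : (map f t)`_i = f t`_i.
Proof.
have [ti|ti] := ltnP i (size t); first exact: nth_map.
by rewrite !nth_default ?size_map ?raddf0.
Qed.

Lemma drift_map t w : drift (map f t) w = f (drift t w).
Proof. by elim: w => [|i w IH] /=; rewrite ?raddf0 // raddfD IH nth_map_raddf. Qed.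

Lemma carried_map (le : rel V) (le' : rel W) c t l r w :
    (forall u v, le u v -> le' (f u) (f v)) ->
  carried le c t l r w ->
  carried le' (map f c) (map f t) (f l) (f r) w.
Proof.
move=> fle; elim: w l r => [|i w IH] l r //= /and4P[it cl rc /IH Hw].
by rewrite size_map it !nth_map_raddf !fle // -!raddfD.
Qed.

Lemma level_map t C k :
  level (map f t) (map_tower C) k =
  (f (level t C k).1, f (level t C k).2).
Proof. by rewrite /level drift_map !raddfD. Qed.

Lemma chain_map (s : seq (V * V)) x y :
  chain x s y -> chain (f x) [seq (f p.1, f p.2) | p <- s] (f y).
Proof.
by elim: s x => [|p s IH] x /= => [/eqP->//|/andP[/eqP<- /IH ->]]; rewrite eqxx.
Qed.

Lemma chain_levels_map t (Cs : nat -> tower V) (s : seq (nat * nat)) x y :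
  chain x (levels t Cs s) y ->
  chain (f x) (levels (map f t) (map_tower \o Cs) s) (f y).
Proof.
move=> /chain_map; rewrite -map_comp; congr chain.
by apply: eq_map => p /=; rewrite level_map.
Qed.

End TowersMorphism.

Section PiecewiseTranslations.
Context {R : realDomainType}.
Implicit Types (c t : seq R) (l r x y z : R) (w : seq nat) (T F : R -> R).

(** [T] translates the [i]-th piece by [t`_i]. *)
Definition translates c t T : Prop :=
  forall i x, (i < size t)%N -> c`_i <= x < c`_i.+1 -> T x = x + t`_i.

Lemma carried_iter c t T l r w k x :
    translates c t T -> carried <=%R c t l r w -> (k <= size w)%N ->
  l <= x < r -> iter k T x = x + drift t (take k w).
Proof.
move=> HT; elim: w l r k x => [|i w IH] l r [|k] x //=; rewrite ?addr0 //.
move=> /and4P[it cl rc Hw] ks /andP[lx xr].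
rewrite -iterS iterSr (HT i) ?(le_trans cl) ?(lt_le_trans xr) //.
by rewrite (IH _ _ _ _ Hw) ?addrA // lerD2r ltrD2r lx.
Qed.

(** No bound on [k] is needed: past the end of the itinerary, [take] keeps all of
    it. *)
Lemma climbs_iter c t T C k x :
    translates c t T -> climbs <=%R c t C -> low C <= x < high C ->
  exists n, iter n T x = x + drift t (take k (route C)).
Proof.
move=> HT HC Cx; exists (minn k (size (route C))).
rewrite (carried_iter HT HC) ?geq_minr //; congr (_ + drift t _).
by rewrite /minn; case: ltnP => // sk; rewrite take_size take_oversize.
Qed.

Lemma chain_cover x (s : seq (R * R)) y z : chain x s y -> x <= z < y ->
  exists2 p, p \in s & p.1 <= z < p.2.
Proof.
elim: s x => [|p s IH] x /=; first by move=> /eqP -> /andP[yz /lt_geF]; rewrite yz.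
move=> /andP[/eqP <- ps] /andP[pz zy]; have [zp|pz'] := ltP z p.2.
  by exists p; rewrite ?mem_head ?pz.
have [|q qs qz] := IH _ ps; first by rewrite pz'.
by exists q => //; rewrite inE qs orbT.
Qed.

Lemma nth_cover c n y : c`_0 <= y < c`_n ->
  exists2 i, (i < n)%N & c`_i <= y < c`_i.+1.
Proof.
elim: n => [/andP[+ /lt_geF]|n IH /andP[y0 yn]]; first by move=> ->.
have [yn'|yn'] := ltP y c`_n; last by exists n; rewrite ?yn'.
by have [|i /ltnW Hi Hy] := IH; [rewrite y0|exists i].
Qed.

Lemma levels_cover t Cs s x y z :
    chain x (levels t Cs s) y -> x <= z < y ->
  exists2 p, p \in s & exists2 v, low (Cs p.1) <= v < high (Cs p.1) &
    z = v + drift t (take p.2 (route (Cs p.1))).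
Proof.
move=> ch xz; have [_ /mapP[p ps ->] /= /andP[lz zr]] := chain_cover ch xz.
exists p => //; exists (z - drift t (take p.2 (route (Cs p.1)))).
  by rewrite lerBrDr lz ltrBlDr.
by rewrite subrK.
Qed.

End PiecewiseTranslations.

(** * Formal combinations of 1, a, b, d *)

(** [(f0, f1, f2, f3)] stands for f0 + f1 a + f2 b + f3 d. *)
Definition form : Type := (int * int * int * int)%type.
HB.instance Definition _ := GRing.Zmodule.on form.

(** [f] with the value [g], an expression free of d, substituted for d. *)
Definition at_const (f g : form) : form :=
  let: (f0, f1, f2, f3) := f in let: (g0, g1, g2, _) := g in
  (f0 + f3 * g0, f1 + f3 * g1, f2 + f3 * g2, 0).

(** A common denominator D and bounds for D a and for D b. *)
Definition box : int * (int * int) * (int * int) :=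
  (1000, (543, 544), (295, 296)).

(** Sufficient condition for an expression free of d to be nonnegative: the
    minimum over the box of rational bounds on a and b is nonnegative. *)
Definition box_nonneg (f : form) : bool :=
  let: (f0, f1, f2, _) := f in
  let: (D, (la, ua), (lb, ub)) := box in
  0 <= D * f0 + Num.min (la * f1) (ua * f1) + Num.min (lb * f2) (ub * f2).

(** Sufficient condition for [f <= g] when d lies between [lo] and [hi]: both
    sides are affine in d, so it is enough to compare them at the end points. *)
Definition form_le (lo hi : form) (f g : form) : bool :=
  box_nonneg (at_const (g - f) lo) && box_nonneg (at_const (g - f) hi).

(** Multiplication by b when f3 d becomes f3 (b d): it uses a b = 1 - a - b and
    b^2 = 2 a - 1. *)
Definition times_b (f : form) : form :=
  let: (f0, f1, f2, f3) := f in (f1 - f2, 2 * f2 - f1, f0 - f1, f3).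

Arguments times_b : simpl never.

Section Evaluation.
Context {R : realFieldType}.
Variables (a b : R).
Implicit Types (d : R) (f g lo hi : form).

(** The value of a form; it is additive in the form. *)
Definition ev d f : R :=
  let: (f0, f1, f2, f3) := f in f0%:~R + f1%:~R * a + f2%:~R * b + f3%:~R * d.

Fact ev_is_zmod_morphism d : zmod_morphism (ev d).
Proof.
by move=> [[[f0 f1] f2] f3] [[[g0 g1] g2] g3]; rewrite /ev/= !rmorphB /=; ring.
Qed.

HB.instance Definition _ d :=
  GRing.isZmodMorphism.Build form R (ev d) (ev_is_zmod_morphism d).

Arguments ev : simpl never.

(** a is the real root of a^3 + a^2 + a = 1 and b = a^2, through the relations and
    the numerical bounds that are used. *)
Definition tribonacci : Prop :=
  let: (D, (la, ua), (lb, ub)) := box in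
  [/\ b * a = 1 - a - b, b * b = 2 * a - 1,
      la%:~R <= D%:~R * a <= ua%:~R & lb%:~R <= D%:~R * b <= ub%:~R].

Hypothesis ab : tribonacci.

Lemma min_mulz_le (m n k : int) (x : R) : m%:~R <= x <= n%:~R ->
  (Num.min (m * k) (n * k))%:~R <= k%:~R * x.
Proof.
move=> /andP[mx xn]; have [k0|k0] := leP 0 k.
  rewrite (le_trans (y := (m * k)%:~R)) ?ler_int ?ge_min ?lexx //.
  by rewrite rmorphM /= mulrC ler_wpM2l // ler0z.
rewrite (le_trans (y := (n * k)%:~R)) ?ler_int ?ge_min ?lexx ?orbT //.
by rewrite rmorphM /= mulrC ler_wnM2l // lerz0 ltW.
Qed.

Lemma box_nonnegP d (f0 f1 f2 : int) :
  box_nonneg (f0, f1, f2, 0) -> 0 <= ev d (f0, f1, f2, 0).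
Proof.
have : 0 < box.1.1 by [].
move: ab; rewrite /tribonacci /box_nonneg.
move: box => [[D [la ua]] [lb ub]] /= [_ _ Ha Hb] D0.
rewrite /ev -(ler0z R) !rmorphD rmorphM /= mul0r addr0 => H.
have H1 := min_mulz_le f1 Ha; have H2 := min_mulz_le f2 Hb.
rewrite -(@pmulr_rge0 _ D%:~R) ?ltr0z // (le_trans H) // !mulrDr.
by rewrite !(mulrCA D%:~R) -!addrA lerD2l lerD.
Qed.

Lemma form_leP lo hi d f g : ev 0 lo <= d <= ev 0 hi -> form_le lo hi f g ->
  ev d f <= ev d g.
Proof.
move=> /andP[lod dhi] /andP[]; rewrite -[ev d f <= _]subr_ge0 -raddfB.
case: (g - f) => [[[h0 h1] h2] h3]; move: lo hi lod dhi.
move=> [[[l0 l1] l2] l3] [[[u0 u1] u2] u3] /= lod dhi.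
move=> /(box_nonnegP 0) Hl /(box_nonnegP 0) Hu.
move: Hl Hu; rewrite /ev !rmorphD !rmorphM /= !mulr0 !addr0 in lod dhi *.
move: lod dhi; set L := _ + _ * b; set U := _ + _ * b => Ld dU Hl Hu.
have [h30|h30] := leP 0 (h3%:~R : R).
  have : h3%:~R * L <= h3%:~R * d by rewrite ler_wpM2l.
  by rewrite /L; lra.
have : h3%:~R * U <= h3%:~R * d by rewrite ler_wnM2l // ltW.
by rewrite /U; lra.
Qed.

Lemma ev_times_b d f : ev (b * d) (times_b f) = b * ev d f.
Proof.
have [Ha Hb] : b * a = 1 - a - b /\ b * b = 2 * a - 1 by case: ab.
move: f => [[[f0 f1] f2] f3].
rewrite /times_b /ev /= !rmorphB /= rmorphM /= !mulrDr !(mulrCA b) Ha Hb.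
by ring.
Qed.

End Evaluation.
Arguments ev : simpl never.

(** * The family of interval exchanges: combinatorial data *)

(** The end points of the seven pieces. *)
Definition cutF : seq form :=
  [:: (0, 0, 0, 0); (1, -1, -1, -1); (1, -1, 0, 0); (1, 0, -1, 0); (1, 1, -1, -1);
      (1, 1, 0, 0); (1, 1, 1, -1); (2, 0, 0, 0)].

Arguments cutF : simpl never.

(** The translation amounts of the seven pieces. *)
Definition shiftF : seq form :=
  [:: (0, 1, 1, 0); (1, 1, 0, 0); (-1, 1, 0, 0); (1, -1, 0, 0);
      (-1, 0, 1, 0); (-1, 0, -1, 0); (0, -1, -1, 0)].

Arguments shiftF : simpl never.

(** The powers a^3, a^4 and a^5. *)
Definition pow3F : form := (1, -1, -1, 0).
Definition pow4F : form := (-1, 2, 0, 0).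
Definition pow5F : form := (0, -1, 2, 0).

(** The left end point a - b of the interval to which one returns. *)
Definition baseF : form := (0, 1, -1, 0).

Arguments baseF : simpl never.

(** The itineraries, until the first return, of the seven subintervals of the
    base interval. *)
Definition return_routes : seq (seq nat) :=
  [:: [:: 1; 5]; [:: 1; 6; 3; 4]; [:: 1; 6; 3; 5]; [:: 2; 0; 3; 4];
      [:: 2; 1; 5]; [:: 3; 3; 5]; [:: 3; 4]]%N.

(** The tower over the image of the [i]-th piece by y |-> (a - b) + b y.  If the
    cut points are those of parameter d, [times_b] makes this a tower for
    parameter b d. *)
Definition return_tower (i : nat) : tower form :=
  Tower (baseF + times_b cutF`_i) (baseF + times_b cutF`_i.+1)
        (nth [::] return_routes i).

(** For each piece [j], the levels of the return towers that tile it, from left to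
    right; [(i, k)] is level [k] of the [i]-th return tower. *)
Definition return_tiling : seq (seq (nat * nat)) :=
  [:: [:: (3, 1)];
      [:: (4, 1); (0, 0); (1, 0); (2, 0)];
      [:: (3, 0); (4, 0)];
      [:: (5, 0); (6, 0); (3, 2); (1, 2); (2, 2); (5, 1)];
      [:: (6, 1); (3, 3); (1, 3)];
      [:: (2, 3); (5, 2); (4, 2); (0, 1)];
      [:: (1, 1); (2, 1)]]%N.

(** The levels other than the base and the return are disjoint from the base
    interval. *)
Definition avoids_base (C : tower form) : bool :=
  all (fun k => form_le (- pow5F) pow5F (baseF + times_b (2, 0, 0, 0))
                        (level shiftF C k).1
             || form_le (- pow5F) pow5F (level shiftF C k).2 baseF)
      (iota 1 (size (route C)).-1).

Lemma return_towerP :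
  all (fun i => let C := return_tower i in
    [&& climbs (form_le (- pow5F) pow5F) cutF shiftF C,
        drift shiftF (route C) == times_b shiftF`_i,
        route C != [::] & avoids_base C]) (iota 0 7).
Proof. by vm_compute. Qed.

Lemma return_tilingP :
  all (fun j => let s := nth [::] return_tiling j in
    all (fun p => p.1 < 7)%N s &&
    chain cutF`_j (levels shiftF return_tower s) cutF`_j.+1) (iota 0 7).
Proof. by vm_compute. Qed.

(** For d between [lo] and [hi], the towers [Cs] come back to their bases by the
    identity, and their levels, in the order [s], tile [0, 2). *)
Definition cycle_check (lo hi : form) (Cs : seq (tower form))
    (s : seq (nat * nat)) : bool :=
  [&& all (fun p => p.1 < size Cs)%N s,
      all (fun C => [&& climbs (form_le lo hi) cutF shiftF C,
                        drift shiftF (route C) == 0 & route C != [::]]) Cs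
    & chain 0 (levels shiftF (nth (Tower 0 0 [::]) Cs) s) (2, 0, 0, 0)].

(** The periodic towers for a^4 <= d <= a^3, - a^3 <= d <= - a^4,
    a^5 <= d <= a^4 and - a^4 <= d <= - a^5, with the order of their levels. *)
Definition cycles_large_pos : seq (tower form) :=
  [::
    Tower 0 (1, -1, -1, -1)
      [:: 0; 3; 4; 2; 1; 5; 1; 6; 3; 5; 1; 6; 3; 4; 3; 4; 2]%N;
    Tower (1, -1, -1, -1) (-1, 1, 2, 0)
      [:: 1; 5; 1; 6; 3; 4; 3; 4; 2]%N;
    Tower (0, 0, 1, -1) (0, 1, -1, 0)
      [:: 1; 6; 3; 4; 2]%N;
    Tower (0, 1, 0, -1) (1, -1, 0, 0)
      [:: 1; 6; 4]%N].

Definition tiling_large_pos : seq (nat * nat) :=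
  [::
    (0, 0); (1, 0); (0, 4); (2, 0); (0, 10); (1, 2); (0, 6); (3, 0); (0, 16);
    (1, 8); (0, 3); (2, 4); (0, 14); (1, 6); (0, 1); (2, 2); (0, 12); (1, 4);
    (0, 8); (3, 2); (0, 15); (1, 7); (0, 2); (2, 3); (0, 13); (1, 5); (0, 9);
    (1, 1); (0, 5); (2, 1); (0, 11); (1, 3); (0, 7); (3, 1)]%N.

Definition cycles_large_neg : seq (tower form) :=
  [::
    Tower 0 (0, 1, -2, -1)
      [:: 0; 3; 3; 5; 2]%N;
    Tower (0, 1, -2, -1) (1, 0, -3, 0)
      [:: 0; 3; 4; 2; 0; 3; 4; 3; 3; 5; 1; 6; 3; 5; 1; 5; 2]%N;
    Tower (1, 0, -3, 0) (-1, 2, 0, -1)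
      [:: 0; 3; 4; 3; 3; 5; 1; 5; 2]%N;
    Tower (0, 1, -1, 0) (1, -1, -1, -1)
      [:: 0; 3; 5]%N].

Definition tiling_large_neg : seq (nat * nat) :=
  [::
    (0, 0); (1, 0); (2, 0); (1, 4); (3, 0); (1, 14); (2, 6); (1, 10); (0, 4);
    (1, 16); (2, 8); (1, 3); (2, 3); (1, 7); (0, 1); (1, 1); (2, 1); (1, 5);
    (3, 1); (1, 12); (2, 4); (1, 8); (0, 2); (1, 2); (2, 2); (1, 6); (3, 2);
    (1, 13); (2, 5); (1, 9); (0, 3); (1, 15); (2, 7); (1, 11)]%N.

Definition cycles_small_pos : seq (tower form) :=
  [::
    Tower 0 (-1, 2, 0, -1)
      [:: 0; 3; 4; 2; 1; 5; 1; 6; 3; 5; 1; 6; 3; 4; 3; 3; 5; 1; 6; 3; 4; 3; 4;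
         2; 0; 3; 4; 2; 1; 5; 2]%N;
    Tower (-1, 2, 0, -1) (2, -3, -1, 0)
      [:: 0; 3; 4; 2; 1; 5; 1; 6; 3; 5; 1; 6; 3; 4; 3; 4; 2]%N;
    Tower (1, -1, -1, -1) (-1, 1, 2, 0)
      [:: 1; 5; 1; 6; 3; 4; 3; 4; 2]%N;
    Tower (0, 0, 1, -1) (0, 1, -1, 0)
      [:: 1; 6; 3; 4; 2]%N].

Definition tiling_small_pos : seq (nat * nat) :=
  [::
    (0, 0); (1, 0); (0, 24); (2, 0); (0, 4); (1, 4); (0, 28); (3, 0);
    (0, 10); (1, 10); (0, 17); (2, 2); (0, 6); (1, 6); (0, 30); (1, 16);
    (0, 23); (2, 8); (0, 3); (1, 3); (0, 27); (3, 4); (0, 14); (1, 14);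
    (0, 21); (2, 6); (0, 1); (1, 1); (0, 25); (3, 2); (0, 12); (1, 12);
    (0, 19); (2, 4); (0, 8); (1, 8); (0, 15); (1, 15); (0, 22); (2, 7);
    (0, 2); (1, 2); (0, 26); (3, 3); (0, 13); (1, 13); (0, 20); (2, 5);
    (0, 9); (1, 9); (0, 16); (2, 1); (0, 5); (1, 5); (0, 29); (3, 1);
    (0, 11); (1, 11); (0, 18); (2, 3); (0, 7); (1, 7)]%N.

Definition cycles_small_neg : seq (tower form) :=
  [::
    Tower 0 (0, 1, -2, -1)
      [:: 0; 3; 3; 5; 2]%N;
    Tower (0, 1, -2, -1) (-1, 3, -2, 0)
      [:: 0; 3; 4; 2; 0; 3; 4; 3; 3; 5; 1; 6; 3; 4; 3; 3; 5; 1; 6; 3; 5; 1; 5;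
         2; 0; 3; 4; 2; 1; 5; 2]%N;
    Tower (-1, 3, -2, 0) (2, -2, -3, -1)
      [:: 0; 3; 4; 2; 0; 3; 4; 3; 3; 5; 1; 6; 3; 5; 1; 5; 2]%N;
    Tower (1, 0, -3, 0) (-1, 2, 0, -1)
      [:: 0; 3; 4; 3; 3; 5; 1; 5; 2]%N].

Definition tiling_small_neg : seq (nat * nat) :=
  [::
    (0, 0); (1, 0); (2, 0); (1, 24); (3, 0); (1, 4); (2, 4); (1, 28);
    (2, 14); (1, 21); (3, 6); (1, 10); (2, 10); (1, 17); (0, 4); (1, 30);
    (2, 16); (1, 23); (3, 8); (1, 3); (2, 3); (1, 27); (3, 3); (1, 7);
    (2, 7); (1, 14); (0, 1); (1, 1); (2, 1); (1, 25); (3, 1); (1, 5); (2, 5);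
    (1, 12); (2, 12); (1, 19); (3, 4); (1, 8); (2, 8); (1, 15); (0, 2);
    (1, 2); (2, 2); (1, 26); (3, 2); (1, 6); (2, 6); (1, 13); (2, 13);
    (1, 20); (3, 5); (1, 9); (2, 9); (1, 16); (0, 3); (1, 29); (2, 15);
    (1, 22); (3, 7); (1, 11); (2, 11); (1, 18)]%N.

Lemma cycle_checks :
  [&& cycle_check pow4F pow3F cycles_large_pos tiling_large_pos,
      cycle_check (- pow3F) (- pow4F) cycles_large_neg tiling_large_neg,
      cycle_check pow5F pow4F cycles_small_pos tiling_small_pos
    & cycle_check (- pow4F) (- pow5F) cycles_small_neg tiling_small_neg].
Proof. by vm_compute. Qed.

(** For |d| <= a^3, the pieces and their images lie in [0, 2), and the lengths are
    nonnegative. *)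
Lemma cutF_checks :
  all (fun i => let le := form_le (- pow3F) pow3F in
    [&& le 0 cutF`_i, le cutF`_i cutF`_i.+1, le cutF`_i.+1 (2, 0, 0, 0),
        le 0 (cutF`_i + shiftF`_i) & le (cutF`_i.+1 + shiftF`_i) (2, 0, 0, 0)])
    (iota 0 7).
Proof. by vm_compute. Qed.

(** The pieces in the order of their images. *)
Definition image_order : seq nat := [:: 2; 5; 4; 0; 6; 3; 1]%N.

Lemma image_chainF :
  chain 0 [seq (cutF`_i + shiftF`_i, cutF`_i.+1 + shiftF`_i) | i <- image_order]
    (2, 0, 0, 0).
Proof. by vm_compute. Qed.

(** * Increments and measures of consecutive intervals *)

Lemma geometric_lt {R : realType} (q K e : R) : 0 <= q < 1 -> 0 < e ->
  exists n, K * q ^+ n < e.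
Proof.
move=> /andP[q0 q1] e0; have K1 : 0 < `|K| + 1 by rewrite ltr_wpDl.
have q1' : `|q| < 1 by rewrite ger0_norm.
have /cvgr0Pnorm_lt/(_ (e / (`|K| + 1)) (divr_gt0 e0 K1)) [n _ /(_ n)] := cvg_expr q1'.
move=> /(_ (leqnn n)) /=; rewrite ger0_norm ?exprn_ge0 // ltr_pdivlMr // => H.
exists n; rewrite (le_lt_trans _ H) // mulrC ler_wpM2l ?exprn_ge0 //.
by rewrite (le_trans (ler_norm K)) // lerDl.
Qed.

Section Increments.
Context {R : realDomainType}.
Implicit Types (c t : seq R) (l r x y z : R) (w : seq nat) (F : R -> R).

(** On each closed piece, the increments of [F] agree with those on the translated
    piece.  This is the property of x |-> mu [0, x) for an invariant measure mu. *)
Definition invariant_increments c t F : Prop :=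
  forall i x y, (i < size t)%N -> c`_i <= x -> x <= y -> y <= c`_i.+1 ->
  F (y + t`_i) - F (x + t`_i) = F y - F x.

Lemma carried_increments c t F l r w k x y :
    invariant_increments c t F -> carried <=%R c t l r w ->
    l <= x -> x <= y -> y <= r ->
  F (y + drift t (take k w)) - F (x + drift t (take k w)) = F y - F x.
Proof.
move=> HF; elim: w l r k x y => [|i w IH] l r [|k] x y //=; rewrite ?addr0 //.
move=> /and4P[it cl rc Hw] lx xy yr; rewrite !addrA.
rewrite (IH _ _ _ _ _ Hw) ?lerD2r //.
by rewrite HF // ?(le_trans cl) // (le_trans yr).
Qed.

Lemma chain_increment F x (s : seq (R * R)) y : chain x s y ->
  F y - F x = \sum_(p <- s) (F p.2 - F p.1).
Proof.
elim: s x => [|p s IH] x /=; first by move=> /eqP ->; rewrite subrr big_nil.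
by move=> /andP[/eqP <- /IH E]; rewrite big_cons -E [RHS]addrC subrKA.
Qed.

(** A function with the same value at both ends of each link takes the initial
    value at the left end of the link containing a given point. *)
Lemma chain_cover_constant F x (s : seq (R * R)) y z : chain x s y ->
    (forall p, p \in s -> F p.2 = F p.1) -> x <= z < y ->
  exists p, [/\ p \in s, p.1 <= z < p.2 & F p.1 = F x].
Proof.
elim: s x => [|p s IH] x /=; first by move=> /eqP -> _ /andP[yz /lt_geF]; rewrite yz.
move=> /andP[/eqP <- ps] Fs /andP[pz zy]; have [zp|pz'] := ltP z p.2.
  by exists p; rewrite mem_head pz.
have [||q [qs qz qF]] := IH _ ps; first by move=> q qs; rewrite Fs // inE qs orbT.
  by rewrite pz'.
by exists q; rewrite inE qs orbT qF Fs ?mem_head.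
Qed.

End Increments.

Section IntervalMeasures.
Context {R : realType}.
Implicit Types (x y z t : R) (A : set (measurableTypeR R)).
Local Notation measureR := {measure set (measurableTypeR R) -> \bar R}.

Lemma measurable_translation t :
  measurable_fun setT ((fun x => x + t) : measurableTypeR R -> measurableTypeR R).
Proof.
apply: continuous_measurable_fun => x.
by apply: cvgD; [exact: cvg_id|exact: cvg_cst].
Qed.

Lemma measurable_preimage_translation t A : measurable A ->
  measurable ((fun x : measurableTypeR R => (x + t : measurableTypeR R)) @^-1` A).
Proof.
by move=> mA; rewrite -[X in measurable X]setTI; exact: measurable_translation.
Qed.

Lemma lebesgue_measure_translation t A : measurable A ->
  lebesgue_measure ((fun x : measurableTypeR R => (x + t : measurableTypeR R)) @^-1` A) =
  lebesgue_measure A.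
Proof.
move=> mA; apply/esym.
apply: (@lebesgue_measure_unique R (pushforward lebesgue_measure
  ((fun x => x + t) : measurableTypeR R -> measurableTypeR R))) => //.
  exact: measurable_translation.
move=> mt _ [[x y] _ <-] /=; rewrite /pushforward.
have -> : (fun z : R => z + t) @^-1` `]x, y]%classic = `]x - t, y - t]%classic.
  by apply/seteqP; split=> z /=; rewrite !in_itv /= ltrBlDr lerBrDr.
by rewrite !lebesgue_measure_itv /= !lte_fin ltrD2r -!EFinB opprB addrA subrK.
Qed.

Lemma chain_le x (s : seq (R * R)) y : chain x s y ->
  (forall p, p \in s -> p.1 <= p.2) -> x <= y.
Proof.
elim: s x => [|p s IH] x /=; first by move=> /eqP -> _.
move=> /andP[/eqP <- ps] sle; rewrite (le_trans (sle p (mem_head _ _))) //.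
by apply: IH => // q qs; apply: sle; rewrite inE qs orbT.
Qed.

Lemma measure_chain (mu : measureR) A x (s : seq (R * R)) y : measurable A ->
  chain x s y -> (forall p, p \in s -> p.1 <= p.2) ->
  (mu (`[x, y[ `&` A) = \sum_(p <- s) mu (`[p.1, p.2[ `&` A))%E.
Proof.
move=> mA; elim: s x => [|p s IH] x /=.
  by move=> /eqP -> _; rewrite big_nil set_itvE ?set0I ?measure0.
move=> /andP[/eqP <- ps] sle; have p12 := sle p (mem_head _ _).
have sle' q : q \in s -> q.1 <= q.2 by move=> qs; apply: sle; rewrite inE qs orbT.
rewrite big_cons -(IH _ ps sle') (@itv_bndbnd_setU _ _ _ (BLeft p.2)) ?bnd_simp //; last first.
  exact: chain_le ps sle'.
rewrite setIUl measureU //; try exact: measurableI.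
apply/seteqP; split=> // z [[/= + _] [+ _]].
by rewrite !in_itv /= => /andP[_ zp] /andP[/(lt_le_trans zp)]; rewrite ltxx.
Qed.

End IntervalMeasures.

(** * Renormalization and periodicity *)

Section Family.
Context {R : realType}.
Variables (a b : R).
Hypothesis ab : tribonacci a b.
Implicit Types (d e x y z : R) (T F : R -> R) (C : tower form).

Definition cuts d : seq R := map (ev a b d) cutF.
Definition shifts d : seq R := map (ev a b d) shiftF.

Lemma cutsE d : cuts d =
  [:: 0; 1 - a - b - d; 1 - a; 1 - b; 1 + a - b - d; 1 + a; 1 + a + b - d; 2].
Proof. by rewrite /cuts /cutF /ev /=; congr [:: _; _; _; _; _; _; _; _]; ring. Qed.

Lemma shiftsE d : shifts d =
  [:: a + b; 1 + a; a - 1; 1 - a; b - 1; - b - 1; - a - b].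
Proof. by rewrite /shifts /shiftF /ev /=; congr [:: _; _; _; _; _; _; _]; ring. Qed.

Lemma ev_base d : ev a b d baseF = a - b.
Proof. by rewrite /ev /=; ring. Qed.

Lemma ev_two d : ev a b d (2, 0, 0, 0) = 2.
Proof. by rewrite /ev /=; ring. Qed.

Lemma ev_pow3 d : ev a b d pow3F = 1 - a - b.
Proof. by rewrite /ev /=; ring. Qed.

Lemma ev_pow4 d : ev a b d pow4F = 2 * a - 1.
Proof. by rewrite /ev /=; ring. Qed.

Lemma ev_pow5 d : ev a b d pow5F = 2 * b - a.
Proof. by rewrite /ev /=; ring. Qed.

(** The relation a^2 a^3 = a^5. *)
Lemma tribonacci_pow5 : b * (1 - a - b) = 2 * b - a.
Proof. by rewrite -(ev_pow5 (b * 0)) -(ev_pow3 0) -ev_times_b. Qed.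

Lemma tribonacci_ineq :
  [/\ 1 / 4 <= b, b <= 1 / 3, b <= a, a <= 1 - 2 * b + b / 2
    & 2 * a <= 1 + b /\ 1 <= 2 * a].
Proof.
have le f g : form_le 0 0 f g -> ev a b 0 f <= ev a b 0 g.
  have E0 : ev a b 0 (0 : form) = 0 by exact: raddf0.
  have H0 : ev a b 0 (0 : form) <= 0 <= ev a b 0 (0 : form) by rewrite E0 lexx.
  exact: (form_leP ab H0).
have := le (1, 0, 0, 0) (0, 0, 4, 0) isT.
have := le (0, 0, 3, 0) (1, 0, 0, 0) isT.
have := le (0, 0, 1, 0) (0, 1, 0, 0) isT.
have := le (0, 2, 3, 0) (2, 0, 0, 0) isT.
have := le (0, 2, 0, 0) (1, 0, 1, 0) isT.
have := le (1, 0, 0, 0) (0, 2, 0, 0) isT.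
rewrite /ev => *; split; [lra|lra|lra|lra|split;lra].
Qed.

Lemma climbs_ev lo hi d C : ev a b 0 lo <= d <= ev a b 0 hi ->
  climbs (form_le lo hi) cutF shiftF C ->
  climbs <=%R (cuts d) (shifts d) (map_tower (ev a b d) C).
Proof. by move=> Hd; apply: carried_map => f g; exact: (form_leP ab Hd). Qed.

Lemma cuts_cover d y : 0 <= y < 2 ->
  exists2 i, (i < 7)%N & (cuts d)`_i <= y < (cuts d)`_i.+1.
Proof. by move=> Hy; apply: nth_cover; rewrite cutsE. Qed.

Lemma evD d f g : ev a b d (f + g) = ev a b d f + ev a b d g.
Proof. exact: raddfD. Qed.

Lemma cuts_nth d i : (cuts d)`_i = ev a b d cutF`_i.
Proof. exact: nth_map_raddf. Qed.

Lemma shifts_nth d i : (shifts d)`_i = ev a b d shiftF`_i.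
Proof. exact: nth_map_raddf. Qed.

(** The return towers of parameter [b * d] stand over the images of the pieces of
    parameter [d] by y |-> (a - b) + b y. *)
Lemma return_tower_ev d i : map_tower (ev a b (b * d)) (return_tower i) =
  Tower (a - b + b * (cuts d)`_i) (a - b + b * (cuts d)`_i.+1)
        (nth [::] return_routes i).
Proof.
have E j : ev a b (b * d) (baseF + times_b cutF`_j) = a - b + b * (cuts d)`_j.
  by rewrite evD ev_base (ev_times_b ab) cuts_nth.
by congr Tower; exact: E.
Qed.

Lemma return_climbs d i : `|b * d| <= 2 * b - a -> (i < 7)%N ->
  climbs <=%R (cuts (b * d)) (shifts (b * d))
    (Tower (a - b + b * (cuts d)`_i) (a - b + b * (cuts d)`_i.+1)
        (nth [::] return_routes i)).
Proof.
rewrite ler_norml -(ev_pow5 0) -raddfN => bd i7; rewrite -return_tower_ev.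
apply: climbs_ev bd _; have /allP/(_ i) := return_towerP.
by rewrite mem_iota => /(_ i7)/and4P[].
Qed.

Lemma return_drift d i : (i < 7)%N ->
  drift (shifts (b * d)) (nth [::] return_routes i) = b * (shifts d)`_i.
Proof.
move=> i7; have /allP/(_ i) := return_towerP.
rewrite mem_iota => /(_ i7)/and4P[_ /eqP E _ _].
by rewrite drift_map [drift _ _]E /= shifts_nth (ev_times_b ab).
Qed.

(** Strictly between the base and the return, each level is on one side of the
    base interval. *)
Lemma return_avoids d i k : `|b * d| <= 2 * b - a -> (i < 7)%N ->
    (0 < k < size (nth [::] return_routes i))%N ->
  a - b + 2 * b <= a - b + b * (cuts d)`_i +
     drift (shifts (b * d)) (take k (nth [::] return_routes i)) \/
  a - b + b * (cuts d)`_i.+1 +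
     drift (shifts (b * d)) (take k (nth [::] return_routes i)) <= a - b.
Proof.
rewrite ler_norml -{1}(ev_pow5 0) -(ev_pow5 0) -raddfN => bd i7 /andP[k0 ks].
have /allP/(_ i) := return_towerP.
rewrite mem_iota => /(_ i7)/and4P[_ _ _ /allP/(_ k)].
have -> : route (return_tower i) = nth [::] return_routes i by [].
rewrite mem_iota add1n prednK; last exact: leq_ltn_trans ks.
rewrite k0 ks => /(_ isT).
have := level_map (ev a b (b * d)) shiftF (return_tower i) k.
rewrite return_tower_ev -/(shifts (b * d)) => E /orP[] /(form_leP ab bd) H.
  left; rewrite [leRHS](congr1 fst E) /=; apply: le_trans H.
  by rewrite (evD _ baseF) ev_base (ev_times_b ab) ev_two (mulrC b).
by right; rewrite [leLHS](congr1 snd E) /= (le_trans H) // ev_base.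
Qed.

Lemma return_levels d j : (j < 7)%N ->
  chain (cuts d)`_j
    (levels (shifts d) (map_tower (ev a b d) \o return_tower)
       (nth [::] return_tiling j)) (cuts d)`_j.+1.
Proof.
move=> j7; have /allP/(_ j) := return_tilingP.
rewrite mem_iota => /(_ j7)/andP[_ /(chain_levels_map (ev a b d))].
by rewrite !cuts_nth.
Qed.

Lemma return_tiling_lt j p : p \in nth [::] return_tiling j -> (p.1 < 7)%N.
Proof.
have [j7|j7] := ltnP j 7; last by rewrite nth_default.
have /allP/(_ j) := return_tilingP.
by rewrite mem_iota => /(_ j7)/andP[/allP H _ /H].
Qed.

Lemma tribonacci_gt0 : 0 < b.
Proof. by have [? _ _ _ _] := tribonacci_ineq; lra. Qed.

Lemma norm_times_b d : `|d| <= 1 - a - b -> `|b * d| <= 2 * b - a.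
Proof.
have b0 := tribonacci_gt0.
by move=> d3; rewrite normrM gtr0_norm // -tribonacci_pow5 ler_pM2l.
Qed.

Lemma cuts_checks d i : `|d| <= 1 - a - b -> (i < 7)%N ->
  [/\ 0 <= (cuts d)`_i, (cuts d)`_i <= (cuts d)`_i.+1, (cuts d)`_i.+1 <= 2,
      0 <= (cuts d)`_i + (shifts d)`_i & (cuts d)`_i.+1 + (shifts d)`_i <= 2].
Proof.
rewrite ler_norml -(ev_pow3 0) => Hd i7.
have evN f : - ev a b 0 f = ev a b 0 (- f) by rewrite raddfN.
have E0 : ev a b d (0 : form) = 0 by exact: raddf0.
move: Hd; rewrite evN => Hd; have /allP/(_ i) := cutF_checks.
rewrite mem_iota => /(_ i7)/and5P[].
move=> /(form_leP ab Hd) + /(form_leP ab Hd) + /(form_leP ab Hd) +.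
move=> + + + /(form_leP ab Hd) + /(form_leP ab Hd).
by rewrite E0 ev_two !(evD d) !cuts_nth !shifts_nth.
Qed.

Lemma cuts_order d i : `|d| <= 1 - a - b -> (i < 7)%N ->
  [/\ 0 <= (cuts d)`_i, (cuts d)`_i <= (cuts d)`_i.+1 & (cuts d)`_i.+1 <= 2].
Proof. by move=> d3 /(cuts_checks d3)[]. Qed.

Lemma translates_dom d T y : `|d| <= 1 - a - b ->
  translates (cuts d) (shifts d) T -> 0 <= y < 2 -> 0 <= T y < 2.
Proof.
move=> d3 HT /(cuts_cover d)[i i7 /andP[cy yc]].
have [_ _ _ lo hi] := cuts_checks d3 i7.
rewrite (HT i) ?size_map ?cy // (le_trans lo) ?lerD2r //=.
by rewrite (lt_le_trans _ hi) // ltrD2r.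
Qed.

(** The renormalization: the first return map of the exchange of parameter [b * d]
    to the base interval is conjugate, by y |-> (a - b) + b y, to the exchange of
    parameter [d]. *)
Lemma first_return_base d T T' y : `|b * d| <= 2 * b - a ->
    translates (cuts (b * d)) (shifts (b * d)) T ->
    translates (cuts d) (shifts d) T' -> 0 <= y < 2 ->
  exists n, [/\ (0 < n)%N, iter n T (a - b + b * y) = a - b + b * T' y &
    forall m, (0 < m < n)%N -> ~~ (a - b <= iter m T (a - b + b * y) < a - b + 2 * b)].
Proof.
move=> bd HT HT' /(cuts_cover d)[i i7 Hy].
have b0 := tribonacci_gt0.
have HC := return_climbs bd i7; set C := Tower _ _ _ in HC.
have Hi : low C <= a - b + b * y < high C.
  by rewrite /= lerD2l ltrD2l ler_pM2l ?ltr_pM2l.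
exists (size (nth [::] return_routes i)); split.
- have /allP/(_ i) := return_towerP.
  by rewrite mem_iota => /(_ i7)/and4P[_ _ + _]; rewrite lt0n size_eq0.
- rewrite (carried_iter HT HC _ Hi) // take_size return_drift //.
  by rewrite (HT' i) ?size_map // mulrDr addrA.
move=> m Hm; have /andP[_ /ltnW mn] := Hm.
rewrite (carried_iter HT HC _ Hi) // negb_and -leNgt -ltNge.
move: Hi => /= /andP[lo hi]; have [H|H] := return_avoids bd i7 Hm.
  by rewrite (le_trans H) ?orbT // lerD2r.
by rewrite (lt_le_trans _ H) // ltrD2r.
Qed.

Definition periodic_on T : Prop :=
  forall x, 0 <= x < 2 -> exists2 n, (0 < n)%N & iter n T x = x.

Lemma iter_periodic T n k x : iter n T x = x -> iter n T (iter k T x) = iter k T x.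
Proof. by move=> E; rewrite -iterD addnC iterD E. Qed.

Lemma cycle_check_periodic lo hi Cs s d T : ev a b 0 lo <= d <= ev a b 0 hi ->
  cycle_check lo hi Cs s -> translates (cuts d) (shifts d) T -> periodic_on T.
Proof.
move=> Hd /and3P[/allP Hs /(all_nthP (Tower 0 0 [::])) HCs Hch] HT x Hx.
have := chain_levels_map (ev a b d) Hch.
rewrite (raddf0 (ev a b d)) /= ev_two => ch.
have [p /Hs /= ps [y Hy ->]] := levels_cover ch Hx.
have /and3P[HC /eqP E n0] := HCs _ ps.
have {}HC := climbs_ev Hd HC.
have [k <-] := climbs_iter p.2 HT HC Hy.
set w := route _ in E n0; exists (size w); first by rewrite lt0n size_eq0.
apply: iter_periodic; rewrite (carried_iter HT HC _ Hy) // take_size.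
by rewrite drift_map E raddf0 addr0.
Qed.

(** Every nonzero d with |d| <= a^3 reaches the range a^5 <= |d| <= a^3 after
    finitely many divisions by b. *)
Lemma periodic_far d T : 2 * b - a <= `|d| <= 1 - a - b ->
  translates (cuts d) (shifts d) T -> periodic_on T.
Proof.
have /and4P[c1 c2 c3 c4] := cycle_checks.
have evN f : ev a b 0 (- f) = - ev a b 0 f by exact: raddfN.
move=> /andP[d5 d3]; have [d4|/ltW d4] := leP `|d| (2 * a - 1);
  have [d0|/ltW d0] := leP 0 d;
  rewrite ?(ger0_norm d0) ?(ler0_norm d0) in d3 d4 d5.
- by apply: (cycle_check_periodic _ c3); rewrite ev_pow4 ev_pow5 d5.
- by apply: (cycle_check_periodic _ c4); rewrite !evN ev_pow4 ev_pow5 lerNl d4 lerNr.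
- by apply: (cycle_check_periodic _ c1); rewrite ev_pow3 ev_pow4 d4.
- by apply: (cycle_check_periodic _ c2); rewrite !evN ev_pow3 ev_pow4 lerNl d3 lerNr.
Qed.

(** Every point lies in a tower over the base interval, and the orbits of points
    of the base interval are lifted from parameter [d]. *)
Lemma periodic_lift d T T' : `|d| <= 1 - a - b ->
  translates (cuts (b * d)) (shifts (b * d)) T ->
  translates (cuts d) (shifts d) T' ->
  periodic_on T' -> periodic_on T.
Proof.
move=> d3 HT HT' per x /(cuts_cover (b * d))[j j7 Hx].
have bd := norm_times_b d3.
have [p /return_tiling_lt p7 [z]] := levels_cover (return_levels (b * d) j7) Hx.
rewrite [((_ \o _) _)]return_tower_ev => Hz ->.
have HC := return_climbs bd p7.
have [k <-] := climbs_iter p.2 HT HC Hz.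
have b0 := tribonacci_gt0.
have [y Hy ->] : exists2 y, 0 <= y < 2 & z = a - b + b * y.
  exists ((z - (a - b)) / b); last by rewrite mulrC divfK ?gt_eqF // addrC subrK.
  move: Hz => /andP[/= lz zh]; have [c0 _ c2] := cuts_order d3 p7.
  rewrite divr_ge0 ?(ltW tribonacci_gt0) ?subr_ge0 //=; last first.
    by rewrite (le_trans _ lz) // lerDl mulr_ge0 // ltW.
  rewrite ltr_pdivrMr // ltrBlDl (lt_le_trans zh) // lerD2l mulrC.
  by rewrite ler_pM2r.
have [n n0 Tn] := per y Hy.
have [N N0 TN] : exists2 N, (0 < N)%N &
    iter N T (a - b + b * y) = a - b + b * iter n T' y.
  have Hn m : 0 <= iter m T' y < 2 by elim: m => //= m; exact: (translates_dom d3).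
  case: n n0 {Tn} => // n _; elim: n => [|n [N N0 IH]].
    have [N [N0 E _]] := first_return_base bd HT HT' (Hn 0%N).
    by exists N.
  have [M [M0 E _]] := first_return_base bd HT HT' (Hn n.+1).
  by exists (M + N)%N; rewrite ?addn_gt0 ?M0 // iterD IH E.
by exists N => //; apply: iter_periodic; rewrite TN Tn.
Qed.

Theorem periodic_family (T_ : R -> R -> R) :
    (forall d, `|d| <= 1 - a - b -> translates (cuts d) (shifts d) (T_ d)) ->
  forall d, d != 0 -> `|d| <= 1 - a - b -> periodic_on (T_ d).
Proof.
move=> HT d d0 d3.
have b1 : 0 <= b < 1 by have [? ? _ _ _] := tribonacci_ineq; apply/andP; split; lra.
have d_gt0 : 0 < `|d| by rewrite normr_gt0.
(* The number of divisions by b before reaching a^5 <= |d| is bounded by n. *)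
have [n] := geometric_lt (2 * b - a) b1 d_gt0.
elim: n d d0 d3 {d_gt0} => [|n IH] d d0 d3 Hn.
  by apply: (periodic_far _ (HT d d3)); rewrite d3 andbT ltW // -[ltLHS]mulr1.
have [d5|/ltW d5] := leP (2 * b - a) `|d|.
  by apply: (periodic_far _ (HT d d3)); rewrite d5.
have bp := tribonacci_gt0; have Ed : d = b * (d / b) by rewrite mulrCA divff ?mulr1 ?gt_eqF.
have nd : `|d| = b * `|d / b| by rewrite {1}Ed normrM (gtr0_norm bp).
have d3' : `|d / b| <= 1 - a - b by rewrite -(ler_pM2l bp) -nd tribonacci_pow5.
have HTd := HT d d3; rewrite Ed in HTd *.
apply: (periodic_lift d3' HTd (HT _ d3')); apply: IH => //.
  exact: mulf_neq0 d0 (invr_neq0 (lt0r_neq0 bp)).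
by rewrite -(ltr_pM2l bp) -nd; apply: le_lt_trans Hn; rewrite exprS mulrCA.
Qed.

(** * Renormalization of invariant functions at d = 0 *)

Definition invariant F : Prop := invariant_increments (cuts 0) (shifts 0) F.

(** If [F] is the distribution function of an invariant measure, this is the one
    of its restriction to the base interval, rescaled to [0, 2). *)
Definition renorm F y : R := F (a - b + b * y) - F (a - b).

(** The increment of [F] over the [i]-th piece. *)
Definition mass F i : R := F (cuts 0)`_i.+1 - F (cuts 0)`_i.

(** The action of the incidence matrix of the return words: the entry (j, i) is
    the number of visits to piece [j] of the [i]-th return tower. *)
Definition incidence (v : nat -> R) j : R :=
  \sum_(p <- nth [::] return_tiling j) v p.1.

Lemma norm0_pow3 : `|0 : R| <= 1 - a - b.
Proof. by rewrite normr0; have [_ _ _ ? _] := tribonacci_ineq; have := tribonacci_gt0; lra. Qed.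

Lemma return_climbs0 i : (i < 7)%N -> climbs <=%R (cuts 0) (shifts 0)
    (Tower (a - b + b * (cuts 0)`_i) (a - b + b * (cuts 0)`_i.+1)
        (nth [::] return_routes i)).
Proof.
by have := return_climbs (norm_times_b norm0_pow3) (i := i); rewrite mulr0.
Qed.

Lemma return_drift0 i : (i < 7)%N ->
  drift (shifts 0) (nth [::] return_routes i) = b * (shifts 0)`_i.
Proof. by move=> i7; rewrite -return_drift // mulr0. Qed.

Lemma return_levels0 j : (j < 7)%N ->
  chain (cuts 0)`_j
    [seq (a - b + b * (cuts 0)`_p.1 +
            drift (shifts 0) (take p.2 (nth [::] return_routes p.1)),
          a - b + b * (cuts 0)`_p.1.+1 +
            drift (shifts 0) (take p.2 (nth [::] return_routes p.1)))
       | p <- nth [::] return_tiling j] (cuts 0)`_j.+1.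
Proof.
move=> /(return_levels 0); congr chain; apply: eq_map => p.
by have := return_tower_ev 0 p.1; rewrite mulr0 /= => ->.
Qed.

Lemma renorm_increment F i k x y : invariant F -> (i < 7)%N ->
    (cuts 0)`_i <= x -> x <= y -> y <= (cuts 0)`_i.+1 ->
  let s := drift (shifts 0) (take k (nth [::] return_routes i)) in
  F (a - b + b * y + s) - F (a - b + b * x + s) = renorm F y - renorm F x.
Proof.
move=> HF i7 ix xy yi /=.
rewrite (carried_increments k HF (return_climbs0 i7)) /=; last 3 first.
- by rewrite lerD2l ler_pM2l ?tribonacci_gt0.
- by rewrite lerD2l ler_pM2l ?tribonacci_gt0.
- by rewrite lerD2l ler_pM2l ?tribonacci_gt0.
by rewrite /renorm opprB subrKA.
Qed.

Lemma renorm_invariant F : invariant F -> invariant (renorm F).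
Proof.
move=> HF i x y; rewrite size_map => i7 ix xy yi.
have := renorm_increment (size (nth [::] return_routes i)) HF i7 ix xy yi.
rewrite take_size return_drift0 // => <-.
by rewrite /renorm opprB subrKA -!addrA -!mulrDr.
Qed.

Lemma mass_renorm F j : invariant F -> (j < 7)%N ->
  mass F j = incidence (mass (renorm F)) j.
Proof.
move=> HF j7; rewrite /mass (chain_increment F (return_levels0 j7)) big_map.
rewrite /incidence !big_seq; apply: eq_bigr => p /return_tiling_lt p7 /=.
have [_ c _] := cuts_order norm0_pow3 p7.
by rewrite (renorm_increment _ HF p7) ?lexx.
Qed.

(** The lengths of the pieces. *)
Definition len : nat -> R := mass id.

Lemma len_incidence j : (j < 7)%N -> len j = b * incidence len j.
Proof.
move=> j7; rewrite /len mass_renorm //; last by move=> i x y _ _ _ _; ring.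
rewrite /incidence mulr_sumr; apply: eq_bigr => p _.
by rewrite /mass /renorm; ring.
Qed.

(** The positive left eigenvector of the incidence matrix, for the eigenvalue
    1 / b, as a linear form. *)
Definition height (v : nat -> R) : R :=
  v 0%N + (1 + a + b) * (v 1%N + v 2%N + v 3%N) + (1 + a) * (v 4%N + v 5%N) + v 6%N.

Lemma incidenceE v : [/\ incidence v 0%N = v 3%N,
  incidence v 1%N = v 4%N + v 0%N + v 1%N + v 2%N, incidence v 2%N = v 3%N + v 4%N,
  incidence v 3%N = v 5%N + v 6%N + v 3%N + v 1%N + v 2%N + v 5%N
  & [/\ incidence v 4%N = v 6%N + v 3%N + v 1%N, incidence v 5%N = v 2%N + v 5%N + v 4%N + v 0%N
  & incidence v 6%N = v 1%N + v 2%N]].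
Proof.
by split; [..|split]; rewrite /incidence /= ?(big_cons, big_nil) ?addr0 /= ?addrA.
Qed.

Lemma height_incidence v : b * height (incidence v) = height v.
Proof.
rewrite /height; have [-> -> -> -> [-> -> ->]] := incidenceE v.
have [Ha Hb] : b * a = 1 - a - b /\ b * b = 2 * a - 1 by case: ab.
have A i : b * a * v i = (1 - a - b) * v i by rewrite Ha.
have B i : b * b * v i = (2 * a - 1) * v i by rewrite Hb.
have := (A 0, A 1, A 2, A 3, A 4, A 5, A 6, (B 0, B 1, B 2, B 3, B 4, B 5, B 6))%N.
move=> [] [] [] [] [] [] [] A0 A1 A2 A3 A4 A5 A6 [] [] [] [] [] [] B0 B1 B2 B3 B4 B5 B6.
lra.
Qed.

(** * The incidence matrix has a unique positive direction *)

(** A nonnegative vector with an infinite sequence of nonnegative preimages by the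
    incidence matrix. *)
Definition incidence_orbit (v : nat -> nat -> R) : Prop :=
  forall n j, (j < 7)%N -> v n j = incidence (v n.+1) j /\ 0 <= v n j.

Lemma height_shift v n : incidence_orbit v ->
  height (v n.+1) = b * height (v n).
Proof.
move=> Hv; rewrite -height_incidence; congr (_ * _).
by rewrite /height -!(proj1 (Hv n _ _)).
Qed.

Lemma height_iter v n : incidence_orbit v ->
  height (v n) = b ^+ n * height (v 0%N).
Proof.
move=> Hv; elim: n => [|n IH]; first by rewrite mul1r.
by rewrite height_shift // IH exprS mulrA.
Qed.

Lemma height_bounds (v : nat -> R) : (forall j, (j < 7)%N -> 0 <= v j) ->
  (forall j, (j < 7)%N -> v j <= height v) /\
  height v <= 2 * (v 0%N + v 1%N + v 2%N + v 3%N + v 4%N + v 5%N + v 6%N).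
Proof.
move=> v0; have [Hb Hb' Hab Ha _] := tribonacci_ineq.
have [p0 p1 p2 p3] : [/\ 0 <= v 0%N, 0 <= v 1%N, 0 <= v 2%N & 0 <= v 3%N] by split; exact: v0.
have [p4 p5 p6] : [/\ 0 <= v 4%N, 0 <= v 5%N & 0 <= v 6%N] by split; exact: v0.
have q1 : 0 <= (a + b) * (v 1%N + v 2%N + v 3%N).
  by apply: mulr_ge0; [lra|rewrite !addr_ge0].
have q2 : 0 <= a * (v 4%N + v 5%N) by apply: mulr_ge0; [lra|rewrite !addr_ge0].
have r1 : 0 <= (1 - a - b) * (v 1%N + v 2%N + v 3%N).
  by apply: mulr_ge0; [lra|rewrite !addr_ge0].
have r2 : 0 <= (1 - a) * (v 4%N + v 5%N) by apply: mulr_ge0; [lra|rewrite !addr_ge0].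
split; last by rewrite /height; lra.
by move=> [|[|[|[|[|[|[|//]]]]]]] _; rewrite /height; lra.
Qed.

(** The fifth power of the incidence matrix has positive entries.  All pieces are
    related through piece 3: it contributes to itself in one step, to every piece
    in exactly three steps, and receives from every piece in exactly two. *)
Lemma total_le v j : incidence_orbit v -> (j < 7)%N ->
  v 5%N 0%N + v 5%N 1%N + v 5%N 2%N + v 5%N 3%N + v 5%N 4%N + v 5%N 5%N
    + v 5%N 6%N <= v 0%N j.
Proof.
move=> Hv.
have ge n k : (k < 7)%N -> 0 <= v n k by move=> /(Hv n)[].
have E n k : (k < 7)%N -> v n k = incidence (v n.+1) k by move=> /(Hv n)[].
have to4 n : v n.+1 3%N <= v n 4%N.
  rewrite (E n 4%N) //; have [_ _ _ _ [-> _ _]] := incidenceE (v n.+1).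
  by have := ge n.+1 6%N isT; have := ge n.+1 1%N isT; lra.
have to3 n : v n.+1 3%N + v n.+1 1%N <= v n 3%N.
  rewrite (E n 3%N) //; have [_ _ _ -> _] := incidenceE (v n.+1).
  have := ge n.+1 5%N isT; have := ge n.+1 6%N isT; have := ge n.+1 2%N isT; lra.
have to1 n : v n.+1 4%N <= v n 1%N.
  rewrite (E n 1%N) //; have [_ -> _ _ _] := incidenceE (v n.+1).
  have := ge n.+1 0%N isT; have := ge n.+1 1%N isT; have := ge n.+1 2%N isT; lra.
have from3 : v 5%N 0%N + v 5%N 1%N + v 5%N 2%N + v 5%N 3%N + v 5%N 4%N + v 5%N 5%N
    + v 5%N 6%N <= v 3%N 3%N.
  have := to3 3%N; rewrite (E 4%N 3%N) // (E 4%N 1%N) //.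
  have [_ -> _ -> _] := incidenceE (v 5%N).
  by have := ge 5%N 5%N isT; have := ge 5%N 1%N isT; have := ge 5%N 2%N isT; lra.
have self n : v n.+1 3%N <= v n 3%N by have := to3 n; have := ge n.+1 1%N isT; lra.
have g := ge 1%N.
have h1 := self 1%N; have h2 := self 2%N; have h0 := self 0%N.
have h3 := to4 1%N; have h4 := to4 2%N; have h5 := to4 0%N; have h6 := to1 1%N.
move=> j7; apply: (le_trans from3); rewrite (E 0%N j) //.
have [s0 s1 s2 s3 [s4 s5 s6]] := incidenceE (v 1%N).
have := (g 0%N isT, g 1%N isT, g 2%N isT, g 4%N isT, (g 5%N isT, g 6%N isT)).
move=> [] [] [] [] g0 g1 g2 g4 [] g5 g6.
by move: j j7 => [|[|[|[|[|[|[|//]]]]]]] _; rewrite ?(s0, s1, s2, s3, s4, s5, s6); lra.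
Qed.

Lemma len_bounds j : (j < 7)%N -> 0 <= len j <= 2.
Proof.
move=> j7; have [c0 c1 c2] := cuts_order norm0_pow3 j7.
by rewrite /len /mass subr_ge0 c1 lerBlDr (le_trans c2) // lerDl.
Qed.

Lemma height_len : 0 < height len <= 4.
Proof.
have [Hb Hb' Hab Ha [Ha' _]] := tribonacci_ineq.
have [Hab1 Hb1] : b * a = 1 - a - b /\ b * b = 2 * a - 1 by case: ab.
have len0 j : (j < 7)%N -> 0 <= len j by move=> /len_bounds/andP[].
have [le_height height_le] := height_bounds len0.
apply/andP; split.
  apply: lt_le_trans (le_height 0%N isT).
  by rewrite /len /mass cutsE /=; lra.
apply: le_trans height_le _.
by rewrite /len /mass cutsE /=; lra.
Qed.

(** Consequence of positivity: each [v n] dominates a fixed fraction of its height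
    times the vector of lengths.  Subtracting it leaves a nonnegative orbit.  The
    factor 1 / 4 accounts for lengths up to 2 and coefficients of the height up
    to 2. *)
Lemma height_lower v n j : incidence_orbit v -> (j < 7)%N ->
  b ^+ 5 / 4 * height (v n) * len j <= v n j.
Proof.
move=> Hv j7; have Hvn : incidence_orbit (fun k => v (n + k)%N).
  by move=> k i i7; rewrite addnS; exact: Hv.
have := total_le Hvn j7; rewrite addn0 => H.
have v5 i : (i < 7)%N -> 0 <= v (n + 5)%N i by move=> /(Hv (n + 5)%N)[].
have vn i : (i < 7)%N -> 0 <= v n i by move=> /(Hv n)[].
have [/(_ 0%N isT) h0 _] := height_bounds vn; have [_ h5] := height_bounds v5.
have := height_iter 5 Hvn; rewrite addn0 => E; rewrite E in h5.
have /andP[l0 l2] := len_bounds j7.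
have : b ^+ 5 / 4 * height (v n) * len j <= b ^+ 5 / 4 * height (v n) * 2.
  apply: ler_wpM2l l2; rewrite !mulr_ge0 ?exprn_ge0 ?(ltW tribonacci_gt0) ?invr_ge0 //.
  exact: le_trans (vn 0%N isT) h0.
by lra.
Qed.

(** Iterating the subtraction of [height_lower] multiplies the height by a
    constant [q < 1] and leaves [height len * v j - height v * len j] unchanged;
    the latter is bounded by a multiple of the height, hence vanishes. *)
Lemma incidence_orbit_proportional v j : incidence_orbit v -> (j < 7)%N ->
  height len * v 0%N j = height (v 0%N) * len j.
Proof.
move=> Hv0 j7; set K := height len; set q := 1 - b ^+ 5 / 4 * K.
have /andP[K0 K4] : 0 < K <= 4 := height_len.
have [Hb Hb' _ _ _] := tribonacci_ineq.
have b5 : 0 < b ^+ 5 by rewrite exprn_gt0 ?tribonacci_gt0.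
have q01 : 0 <= q < 1.
  have : b ^+ 5 * K <= 1 * 4.
    by apply: ler_pM => //; [exact: ltW|exact: ltW|rewrite exprn_ile1 //; lra].
  have : 0 < b ^+ 5 * K by rewrite mulr_gt0.
  by rewrite /q => h1 h2; apply/andP; split; lra.
have bound m : forall v, incidence_orbit v ->
    `|K * v 0%N j - height (v 0%N) * len j| <= (K + 2) * height (v 0%N) * q ^+ m.
  elim: m => [|m IH] {Hv0} u Hu.
    have u0 i : (i < 7)%N -> 0 <= u 0%N i by move=> /(Hu 0%N)[].
    have [/(_ _ j7) uj _] := height_bounds u0; have /andP[l0 l2] := len_bounds j7.
    have h0 := le_trans (u0 _ j7) uj.
    rewrite expr0 mulr1 (le_trans (ler_normB _ _)) // !normrM (gtr0_norm K0).
    rewrite (ger0_norm h0) (ger0_norm l0) (ger0_norm (u0 _ j7)).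
    have A : K * u 0%N j <= K * height (u 0%N) by rewrite ler_wpM2l // ltW.
    have B : height (u 0%N) * len j <= height (u 0%N) * 2 by rewrite ler_wpM2l.
    by lra.
  pose w n i := u n i - b ^+ 5 / 4 * height (u n) * len i.
  have hw n : height (w n) = q * height (u n).
    by rewrite /w /q /K /height; ring.
  have Hw : incidence_orbit w.
    move=> n i i7; split; last by rewrite subr_ge0 height_lower.
    have -> : incidence (w n.+1) i = incidence (u n.+1) i -
        b ^+ 5 / 4 * height (u n.+1) * incidence len i.
      by rewrite /incidence mulr_sumr -sumrB.
    rewrite {1}/w {1}(proj1 (Hu n i i7)) (len_incidence i7) height_shift //.
    by ring.
  have := IH _ Hw; rewrite hw exprS; congr (`|_| <= _).
    by rewrite /w /q; ring.
  by ring.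
apply/eqP; rewrite -subr_eq0 -normr_le0; apply/ler_addgt0Pl => e e0.
rewrite addr0; have [n Hn] := geometric_lt ((K + 2) * height (v 0%N)) q01 e0.
exact: le_trans (bound n v Hv0) (ltW Hn).
Qed.

(** * Invariant monotone functions are linear *)

Definition nondecreasing_02 F : Prop :=
  forall x y, 0 <= x -> x <= y -> y <= 2 -> F x <= F y.

(** The mean slope of [F] over [0, 2]. *)
Definition slope F : R := (F 2 - F 0) / 2.

Lemma base_end : a - b + b * 2 <= 2.
Proof. by have [? ? ? ? [? _]] := tribonacci_ineq; lra. Qed.

Lemma renorm_nondecreasing F : nondecreasing_02 F -> nondecreasing_02 (renorm F).
Proof.
move=> HF x y x0 xy y2; rewrite lerD2r; have [_ _ Hab _ _] := tribonacci_ineq.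
apply: HF; last 1 first.
- by rewrite (le_trans _ base_end) // lerD2l ler_pM2l ?tribonacci_gt0.
- by rewrite addr_ge0 ?subr_ge0 // mulr_ge0 // ltW ?tribonacci_gt0.
- by rewrite lerD2l ler_pM2l ?tribonacci_gt0.
Qed.

Lemma iter_renorm F n : invariant F -> nondecreasing_02 F ->
  invariant (iter n renorm F) /\ nondecreasing_02 (iter n renorm F).
Proof.
move=> HF mF; elim: n => [|n [IH1 IH2]] //=.
by split; [exact: renorm_invariant|exact: renorm_nondecreasing].
Qed.

Lemma cuts_first : (cuts 0)`_0 = 0. Proof. by rewrite cutsE. Qed.
Lemma cuts_last : (cuts 0)`_7 = 2. Proof. by rewrite cutsE. Qed.

Lemma mass_sum F : \sum_(j < 7) mass F j = F 2 - F 0.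
Proof.
have := telescope_sumr (fun i => F (cuts 0)`_i) (isT : (0 <= 7)%N).
by rewrite cuts_first cuts_last big_mkord.
Qed.

(** The masses of all renormalizations of [F] form an orbit of the incidence
    matrix, so they are proportional to the lengths. *)
Lemma mass_len F j : invariant F -> nondecreasing_02 F -> (j < 7)%N ->
  mass F j = slope F * len j.
Proof.
move=> HF mF; pose v n i := mass (iter n renorm F) i.
have Hv : incidence_orbit v.
  move=> n i i7; have [Hn mn] := iter_renorm n HF mF; split; first exact: mass_renorm.
  have [c0 c1 c2] := cuts_order norm0_pow3 i7.
  by rewrite subr_ge0; apply: mn.
have /andP[K0 _] := height_len.
have E i : (i < 7)%N -> mass F i = height (mass F) / height len * len i.
  move=> i7; have := incidence_orbit_proportional Hv i7; rewrite /v /= => E.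
  by rewrite mulrAC -E mulrAC mulfV ?mul1r // gt_eqF.
have -> : slope F = height (mass F) / height len.
  rewrite /slope -mass_sum (eq_bigr (fun i : 'I_7 => height (mass F) / height len * len i)).
    by rewrite -mulr_sumr mass_sum subr0 mulfK // pnatr_eq0.
  by move=> i _; exact: E.
exact: E.
Qed.

Lemma cuts_value F i : invariant F -> nondecreasing_02 F -> (i < 8)%N ->
  F (cuts 0)`_i = F 0 + slope F * (cuts 0)`_i.
Proof.
move=> HF mF; elim: i => [|i IH] i8; first by rewrite cuts_first mulr0 addr0.
have := mass_len HF mF i8; rewrite /len /mass /= IH ?(ltnW i8) // => /eqP.
by rewrite subr_eq => /eqP ->; ring.
Qed.

Lemma slope_renorm F : invariant F -> nondecreasing_02 F ->
  slope (renorm F) = b * slope F.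
Proof.
move=> HF mF; have Hab : b * a = 1 - a - b by case: ab.
have [_ _ ba _ _] := tribonacci_ineq; have a0 : a != 0 by rewrite gt_eqF ?(lt_le_trans tribonacci_gt0).
have := mass_renorm HF (isT : (0 < 7)%N).
have [-> _ _ _ _] := incidenceE (mass (renorm F)).
rewrite (mass_len HF mF) // (mass_len (renorm_invariant HF) (renorm_nondecreasing mF)) //.
rewrite /len /mass cutsE /= => E; apply/(mulIf a0); rewrite [RHS]mulrAC Hab.
by lra.
Qed.

(** The deviation of [F] from its linear approximation at [z] equals that of
    [renorm F] at the point of which [z] is a translate, since the deviation
    vanishes over complete levels; and the slope of [renorm F] is [b * slope F]. *)
Lemma invariant_approx n F z : invariant F -> nondecreasing_02 F -> 0 <= z < 2 ->
  `|F z - F 0 - slope F * z| <= 4 * slope F * b ^+ n.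
Proof.
elim: n F z => [|n IH] F z HF mF /andP[z0 z2].
  have F0 : F 0 <= F z by apply: mF => //; exact: ltW.
  have F2 : F z <= F 2 by apply: mF => //; exact: ltW.
  have s0 : 0 <= slope F by rewrite divr_ge0 // subr_ge0 (le_trans F0).
  have s2 : 2 * slope F = F 2 - F 0 by rewrite /slope; lra.
  have sz : slope F * z <= slope F * 2 by rewrite ler_wpM2l // ltW.
  have sz0 : 0 <= slope F * z by rewrite mulr_ge0.
  by rewrite expr0 ler_norml; apply/andP; split; lra.
have HR := renorm_invariant HF; have mR := renorm_nondecreasing mF.
have [|j j7 zj] := @cuts_cover 0 z; first by rewrite z0.
pose G x := F x - slope F * x.
have ext i x : (i < 7)%N -> (cuts 0)`_i <= x <= (cuts 0)`_i.+1 ->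
  forall k, let s := drift (shifts 0) (take k (nth [::] return_routes i)) in
  G (a - b + b * x + s) - G (a - b + b * (cuts 0)`_i + s) =
  renorm F x - renorm F 0 - slope (renorm F) * x.
  move=> i7 /andP[ix xi] k s; rewrite slope_renorm //.
  have := renorm_increment k HF i7 (lexx _) ix xi; rewrite /= -/s => E.
  have := cuts_value HR mR (ltnW i7 : (i < 8)%N); rewrite slope_renorm // => E'.
  have -> : renorm F x = (renorm F x - renorm F (cuts 0)`_i) + renorm F (cuts 0)`_i.
    by rewrite subrK.
  by rewrite -E E' /G; ring.
have [|p [/mapP[q qs ->] /= zq Gq]] :=
    chain_cover_constant (F := G) (return_levels0 j7) _ zj.
  move=> _ /mapP[q /return_tiling_lt q7 ->] /=; apply/eqP; rewrite -subr_eq0.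
  have [_ c1 _] := cuts_order norm0_pow3 q7; rewrite ext ?c1 ?lexx //.
  rewrite (cuts_value (i := q.1.+1) HR mR q7); apply/eqP; ring.
have q7 := return_tiling_lt qs.
have Gj : G (cuts 0)`_j = F 0 by rewrite /G (cuts_value HF mF (ltnW j7)) addrK.
set s := drift _ _ in zq Gq.
pose y := (z - s - (a - b)) / b.
have Ez : z = a - b + b * y + s.
  by rewrite /y mulrC divfK ?gt_eqF ?tribonacci_gt0 // [X in X + s]addrC !subrK.
have /andP[y1 y2] : (cuts 0)`_q.1 <= y < (cuts 0)`_q.1.+1.
  by move: zq; rewrite Ez lerD2r ltrD2r lerD2l ltrD2l ler_pM2l ?ltr_pM2l ?tribonacci_gt0.
have [c0 c1 c2] := cuts_order norm0_pow3 q7.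
have -> : F z - F 0 - slope F * z = G z - G (a - b + b * (cuts 0)`_q.1 + s).
  by rewrite Gq Gj /G addrAC.
rewrite [in G z]Ez ext ?y1 ?(ltW y2) //.
apply: le_trans (IH _ y HR mR _) _; first by rewrite (le_trans c0) // (lt_le_trans y2).
by rewrite slope_renorm // exprS le_eqVlt; apply/orP; left; apply/eqP; ring.
Qed.

Theorem invariant_linear F z : invariant F -> nondecreasing_02 F -> 0 <= z < 2 ->
  F z = F 0 + slope F * z.
Proof.
move=> HF mF Hz; apply/eqP; rewrite -subr_eq0 opprD addrA -normr_le0.
apply/ler_addgt0Pl => e e0; rewrite addr0.
have b01 : 0 <= b < 1 by have [? ? _ _ _] := tribonacci_ineq; apply/andP; split; lra.
have [n Hn] := geometric_lt (4 * slope F) b01 e0.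
exact: le_trans (invariant_approx n HF mF Hz) (ltW Hn).
Qed.

(** * Measures invariant under the exchange of parameter 0 *)

Section Measures.
Variable T : R -> R.
Hypotheses (HT : translates (cuts 0) (shifts 0) T)
  (T_inj : forall x y, 0 <= x < 2 -> 0 <= y < 2 -> T x = T y -> x = y).
Local Notation D := (`[0, 2[%classic : set (measurableTypeR R)).
Implicit Types (A : set (measurableTypeR R)).

(** The [i]-th piece, its image, and the preimage of a set by the translation of
    that piece. *)
Definition piece i : set (measurableTypeR R) :=
  `[(cuts 0)`_i, (cuts 0)`_i.+1[%classic.

Definition image_piece i : set (measurableTypeR R) :=
  `[(cuts 0)`_i + (shifts 0)`_i, (cuts 0)`_i.+1 + (shifts 0)`_i[%classic.

Definition translation_preimage i A : set (measurableTypeR R) :=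
  (fun x : measurableTypeR R => (x + (shifts 0)`_i : measurableTypeR R)) @^-1` A.

Lemma piece_dom i : (i < 7)%N -> piece i `<=` D.
Proof.
move=> i7 x; rewrite /piece /= !in_itv /= => /andP[cx xc].
have [c0 _ c2] := cuts_order norm0_pow3 i7.
by rewrite (le_trans c0) // (lt_le_trans xc).
Qed.

Lemma piece_preimage i A : (i < 7)%N ->
  piece i `&` (D `&` T @^-1` A) = piece i `&` translation_preimage i A.
Proof.
move=> i7; apply/seteqP; split=> x [px].
all: have Tx : T x = x + (shifts 0)`_i by
  apply: HT; rewrite ?size_map //; move: px; rewrite /piece /= in_itv.
  by move=> [_]; rewrite /preimage /= Tx.
by move=> Ax; split=> //; split; [exact: piece_dom px|rewrite /preimage /= Tx].
Qed.

Lemma measurable_preimage A : measurable A -> measurable (D `&` T @^-1` A).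
Proof.
move=> mA; have -> : D `&` T @^-1` A =
    \bigcup_(i in `I_7) (piece i `&` translation_preimage i A).
  apply/seteqP; split=> x.
    move=> Dx; have [Dx1 _] := Dx; move: Dx1; rewrite /= in_itv /= => /(cuts_cover 0)[i i7 ix].
    exists i => //; have := piece_preimage A i7 => /seteqP[+ _].
    by apply; split=> //; rewrite /piece /= in_itv.
  by move=> [i /= i7] pix; have /seteqP[_ /(_ _ pix)[]] := piece_preimage A i7.
apply: bigcup_measurable => i _; apply: measurableI; first exact: measurable_itv.
exact: measurable_preimage_translation.
Qed.

Lemma piece_chain :
  chain 0 [seq ((cuts 0)`_i, (cuts 0)`_i.+1) | i <- iota 0 7] 2.
Proof. by rewrite cutsE /= !eqxx. Qed.

Lemma image_chain : chain 0
  [seq ((cuts 0)`_i + (shifts 0)`_i, (cuts 0)`_i.+1 + (shifts 0)`_i) | i <- image_order] 2.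
Proof.
have -> : [seq ((cuts 0)`_i + (shifts 0)`_i, (cuts 0)`_i.+1 + (shifts 0)`_i)
    | i <- image_order] = [seq (ev a b 0 p.1, ev a b 0 p.2)
    | p <- [seq (cutF`_i + shiftF`_i, cutF`_i.+1 + shiftF`_i) | i <- image_order]].
  rewrite -map_comp; apply: eq_map => i.
  by rewrite [RHS]/comp [RHS]/= !evD !cuts_nth !shifts_nth.
have E0 : ev a b 0 (0 : form) = 0 by exact: raddf0.
by rewrite -[X in chain X]E0 -[2](ev_two 0); exact: chain_map image_chainF.
Qed.

Lemma lebesgue_invariant : invariant_on D T (@lebesgue_measure R).
Proof.
move=> A mA AD; have mTA := measurable_preimage mA.
have mid i : (i < 7)%N -> (cuts 0)`_i <= (cuts 0)`_i.+1.
  by move=> i7; have [] := cuts_order norm0_pow3 i7.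
transitivity (\sum_(i <- iota 0 7) lebesgue_measure (image_piece i `&` A))%E.
  rewrite -[D `&` _](setIidr (_ : _ `<=` D)); last by move=> x [].
  rewrite (measure_chain _ mTA piece_chain) ?big_map; last first.
    by move=> _ /mapP[i + ->]; rewrite mem_iota => /= i7; exact: mid.
  rewrite [LHS]big_seq [RHS]big_seq; apply: eq_bigr => i; rewrite mem_iota => /= i7.
  rewrite [X in lebesgue_measure X](piece_preimage A i7).
  rewrite -[RHS](lebesgue_measure_translation (shifts 0)`_i); last first.
    have mQ : measurable (image_piece i) by exact: measurable_itv.
    exact: measurableI mQ mA.
  congr lebesgue_measure; apply/seteqP; split=> x [px Ax]; split=> //; move: px;
    by rewrite /piece /image_piece /= !in_itv /= lerD2r ltrD2r.
rewrite (perm_big image_order) //= -[in RHS](setIidr AD).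
rewrite (measure_chain _ mA image_chain) ?big_map //.
move=> _ /mapP[i io ->]; rewrite lerD2r; apply: mid.
by move: io; rewrite !inE => /or4P[|||/or4P[]] /eqP ->.
Qed.

Section FiniteMeasure.
Variable mu : {finite_measure set (measurableTypeR R) -> \bar R}.
Hypothesis mu_inv : invariant_on D T mu.

(** The distribution function of [mu] on [0, 2). *)
Definition cdf x : R := fine (mu `[0, x[%classic).

Lemma cdf_diff x y : 0 <= x -> x <= y -> mu `[x, y[%classic = (cdf y - cdf x)%:E.
Proof.
move=> x0 xy; rewrite EFinB /cdf !fineK ?fin_num_measure //.
rewrite (@itv_bndbnd_setU _ _ (BLeft 0) (BLeft x) (BLeft y)) ?bnd_simp //.
rewrite measureU //; first by rewrite [X in (X - _)%E]addeC addeK ?fin_num_measure.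
apply/seteqP; split=> // z [] /=.
by rewrite !in_itv /= => /andP[_ zx] /andP[/(lt_le_trans zx)]; rewrite ltxx.
Qed.

Lemma cdf0 : cdf 0 = 0.
Proof. by rewrite /cdf set_itvE measure0. Qed.

Lemma cdf_nondecreasing : nondecreasing_02 cdf.
Proof.
move=> x y x0 xy _; rewrite -subr_ge0 -lee_fin -cdf_diff //.
Qed.

Lemma cdf_invariant : invariant cdf.
Proof.
move=> i x y; rewrite size_map => i7 ix xy yi.
have [c0 _ c2 ct0 ct2] := cuts_checks norm0_pow3 i7.
have x0 := le_trans c0 ix; have xt0 : 0 <= x + (shifts 0)`_i.
  by rewrite (le_trans ct0) // lerD2r.
apply: EFin_inj; rewrite -!cdf_diff ?lerD2r // -mu_inv //; last first.
  move=> z /=; rewrite !in_itv /= => /andP[xz zy].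
  by rewrite (le_trans xt0) // (lt_le_trans zy) // (le_trans _ ct2) // lerD2r.
congr (mu _); apply/seteqP; split=> z /=; rewrite /= !in_itv /=; last first.
  move=> /andP[xz zy]; have zi : (cuts 0)`_i <= z < (cuts 0)`_i.+1.
    by rewrite (le_trans ix) // (lt_le_trans zy).
  rewrite (HT _ zi) ?size_map // lerD2r ltrD2r xz zy (le_trans x0) //.
  by rewrite (lt_le_trans zy) // (le_trans yi).
move=> [Dz /andP[xT Ty]]; pose w := T z - (shifts 0)`_i.
have xw : x <= w by rewrite /w lerBrDr.
have wy : w < y by rewrite /w ltrBlDr.
have -> : z = w; last by rewrite xw wy.
apply: T_inj => //; first by rewrite (le_trans x0) // (lt_le_trans wy) // (le_trans yi).
have iw : (cuts 0)`_i <= w < (cuts 0)`_i.+1.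
  by rewrite (le_trans ix) // (lt_le_trans wy).
by rewrite (HT _ iw) ?size_map // /w subrK.
Qed.

Lemma finite_invariant_lebesgue : exists2 c : R, 0 <= c &
  forall A, measurable A -> A `<=` D -> mu A = (c%:E * lebesgue_measure A)%E.
Proof.
have s0 : 0 <= slope cdf.
  by rewrite divr_ge0 // subr_ge0; apply: cdf_nondecreasing => //.
have cdfE z : 0 <= z <= 2 -> cdf z = slope cdf * z.
  move=> /andP[z0]; rewrite le_eqVlt => /predU1P[->|z2].
    by rewrite /slope cdf0 subr0 divfK.
  rewrite (invariant_linear cdf_invariant cdf_nondecreasing) ?cdf0 ?add0r //.
  by rewrite z0.
exists (slope cdf) => // A mA AD.
have mD : measurable D by exact: measurable_itv.
pose m1 := mrestr mu mD; pose m2 := mscale (NngNum s0) (mrestr lebesgue_measure mD).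
have m1E X : m1 X = mu (X `&` D) by [].
have m2E X : m2 X = ((slope cdf)%:E * lebesgue_measure (X `&` D))%E by [].
suff : m1 A = m2 A by rewrite m1E m2E (setIidl AD).
apply: (@measure_unique _ R (measurableTypeR R) (@RGenCInfty.G R)
  (fun k => `[- k%:R, +oo[%classic) _ _ _ _ m1 m2 _ _ A mA).
- exact: RGenCInfty.measurableE.
- move=> _ _ [x ->] [y ->]; exists (Num.max x y); apply/seteqP.
  split=> z /=; rewrite !in_itv /= !andbT ge_max; first by move=> [-> ->].
  by move=> /andP.
- by move=> k; exists (- k%:R).
- apply/seteqP; split=> // x _; exists (Num.bound `|x|) => //=.
  rewrite in_itv /= andbT lerNl (le_trans (ler_norm _)) // normrN ltW //.
  exact: archi_boundP.
- move=> _ [x ->]; rewrite [LHS]m1E [RHS]m2E; pose y := Num.max x 0.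
  have -> : `[x, +oo[%classic `&` D = `[y, 2[%classic.
    apply/seteqP; split=> z /=; rewrite !in_itv /= ge_max andbT.
      by move=> [-> /andP[-> ->]].
    by move=> /andP[/andP[-> ->] ->].
  have y0 : 0 <= y by rewrite /y le_max lexx orbT.
  have [y2|y2] := leP y 2; last first.
    by rewrite set_itv_ge ?bnd_simp -?leNgt ?(ltW y2) // !measure0 mule0.
  rewrite cdf_diff // !cdfE ?y0 ?lexx ?y2 ?ler0n // lebesgue_measure_itv /= lte_fin.
  have [y2'|y2'] := ltP y 2; first by rewrite -EFinB -EFinM -mulrBr.
  have -> : y = 2 by apply: le_anti; rewrite y2.
  by rewrite mule0 subrr.
- move=> k; rewrite [ltLHS]m1E ltey_eq fin_num_measure //.
  by apply: measurableI => //; exact: measurable_itv.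
Qed.

End FiniteMeasure.
End Measures.

End Family.

(** * Interval exchanges *)

Section IntervalExchanges.
Context {R : realType} {d : nat}.
Implicit Types (s : 'S_d) (a : 'rV[R]_d) (i j : 'I_d) (x y : R).

(** Used with the order of the intervals before the exchange and with the order
    after it: an interval lies to the left of those of larger rank. *)
Lemma rank_sum_lt (r : 'I_d -> nat) a i j : (forall k, 0 <= a 0 k) -> (r i < r j)%N ->
  \sum_(k < d | (r k < r i)%N) a 0 k + a 0 i <= \sum_(k < d | (r k < r j)%N) a 0 k.
Proof.
move=> a0 ij; rewrite [leLHS]addrC [leRHS](bigD1 i) //= lerD2l.
rewrite [leLHS]big_mkcond [leRHS]big_mkcond; apply: ler_sum => k _ /=.
case: ifPn => [ki|_]; last by case: ifP.
by rewrite (ltn_trans ki) //; case: eqP ki => [->|//]; rewrite ltnn.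
Qed.

Lemma iet_piece s a i x : (forall k, 0 <= a 0 k) ->
    left_end a i <= x < left_end a i + a 0 i ->
  iet s a x = x + (new_left_end s a i - left_end a i).
Proof.
move=> a0 Hx; rewrite /iet (big_pred1 i) // => j /=; apply/idP/eqP => [Hj|-> //].
have disj k l : left_end a k <= x < left_end a k + a 0 k ->
    left_end a l <= x < left_end a l + a 0 l -> (k < l)%N -> False.
  move=> /andP[_ xk] /andP[lx _] kl.
  have := rank_sum_lt (r := fun i : 'I_d => i) a0 kl; rewrite -!/(left_end _ _) => H.
  by have := lt_le_trans xk (le_trans H lx); rewrite ltxx.
apply/val_inj/eqP; rewrite eqn_leq; apply/andP.
by split; rewrite leqNgt; apply/negP; [exact: disj Hx Hj|exact: disj Hj Hx].
Qed.

Lemma iet_inj_piece s a i j x y : (forall k, 0 <= a 0 k) ->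
    left_end a i <= x < left_end a i + a 0 i ->
    left_end a j <= y < left_end a j + a 0 j ->
  iet s a x = iet s a y -> x = y.
Proof.
move=> a0; wlog : i j x y / (s i <= s j)%N => [IH|].
  have [ij|/ltnW ij] := leqP (s i) (s j); first exact: (IH i j).
  by move=> Hx Hy E; apply/esym; apply: (IH j i).
rewrite leq_eqVlt => /predU1P[/val_inj/perm_inj ->|ij] Hx Hy;
  rewrite (iet_piece s a0 Hx) (iet_piece s a0 Hy); first exact: addIr.
move=> E; have := rank_sum_lt (r := fun i => s i) a0 ij.
rewrite -!/(new_left_end _ _ _) => H.
move: Hx Hy => /andP[_ xi] /andP[jy _]; exfalso.
have : x + (new_left_end s a i - left_end a i) < y + (new_left_end s a j - left_end a j).
  by lra.
by rewrite E ltxx.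
Qed.

Lemma ietZ s a (c : R) x : 0 < c -> iet s (c *: a) x = c * iet s a (x / c).
Proof.
move=> c0; have lZ i : left_end (c *: a) i = c * left_end a i.
  by rewrite /left_end mulr_sumr; apply: eq_bigr => k _; rewrite mxE.
have nZ i : new_left_end s (c *: a) i = c * new_left_end s a i.
  by rewrite /new_left_end mulr_sumr; apply: eq_bigr => k _; rewrite mxE.
rewrite /iet mulrDr mulrC divfK ?gt_eqF // mulr_sumr; congr (_ + _).
apply: eq_big => [i|i _]; last by rewrite lZ nZ mulrBr.
by rewrite lZ mxE -mulrDr ler_pdivlMr // ltr_pdivrMr // ![_ * c]mulrC.
Qed.

End IntervalExchanges.

(** The position of the [i]-th piece after the exchange. *)
Definition rank_of (i : 'I_7) : 'I_7 := inord (nth 0 [:: 3; 6; 0; 5; 2; 1; 4] i)%N.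

Lemma rank_ofE (i : 'I_7) : rank_of i = nth 0%N [:: 3; 6; 0; 5; 2; 1; 4]%N i :> nat.
Proof.
rewrite inordK //; have /(all_nthP 0%N) : all (fun k => k < 7)%N [:: 3; 6; 0; 5; 2; 1; 4]%N by [].
by apply.
Qed.

Lemma rank_of_inj : injective rank_of.
Proof.
move=> i j /(congr1 val) /=; rewrite !rank_ofE => /eqP.
by rewrite nth_uniq // => /eqP/val_inj.
Qed.

Definition sigma : 'S_7 := perm rank_of_inj.

Section FamilyExchange.
Context {R : realType}.
Variables (a b : R).
Hypothesis ab : tribonacci a b.
Implicit Types (d x y : R).

(** The vector of lengths for parameter [d]. *)
Definition lengths d : 'rV[R]_7 := \row_(i < 7) ((cuts a b d)`_i.+1 - (cuts a b d)`_i).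

Lemma lengths_ge0 d i : `|d| <= 1 - a - b -> 0 <= lengths d 0 i.
Proof.
by move=> d3; rewrite mxE subr_ge0; have [] := cuts_order ab d3 (ltn_ord i).
Qed.

Lemma left_end_lengths d i : left_end (lengths d) i = (cuts a b d)`_i.
Proof.
rewrite /left_end; under eq_bigr do rewrite mxE.
have := telescope_sumr (fun i => (cuts a b d)`_i) (leq0n i).
rewrite big_mkord (big_ord_widen 7 (fun k => (cuts a b d)`_k.+1 - (cuts a b d)`_k) (ltnW (ltn_ord i))).
have -> : (cuts a b d)`_0 = 0 by rewrite cutsE.
by rewrite subr0.
Qed.

Lemma total_lengths d : total_length (lengths d) = 2.
Proof.
rewrite /total_length; under eq_bigr do rewrite mxE.
have := telescope_sumr (fun i => (cuts a b d)`_i) (leq0n 7).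
by rewrite big_mkord => ->; rewrite cutsE /= subr0.
Qed.

Lemma new_left_end_lengths d i :
  new_left_end sigma (lengths d) i = (cuts a b d)`_i + (shifts a b d)`_i.
Proof.
rewrite /new_left_end big_mkcond cutsE shiftsE.
under eq_bigr do rewrite mxE !permE !rank_ofE cutsE.
rewrite !big_ord_recl big_ord0 /= /bump /=.
move: i => [[|[|[|[|[|[|[|//]]]]]]] i7] /=; by ring.
Qed.

Lemma translates_iet d : `|d| <= 1 - a - b ->
  translates (cuts a b d) (shifts a b d) (iet sigma (lengths d)).
Proof.
move=> d3 i x; rewrite size_map => i7 Hx; pose j := Ordinal (i7 : (i < 7)%N).
rewrite (iet_piece _ (i := j)).
- by rewrite new_left_end_lengths left_end_lengths /= [_ + (shifts _ _ _)`_i]addrC addrK.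
- by move=> k; exact: lengths_ge0.
by rewrite left_end_lengths mxE addrC subrK.
Qed.

Lemma iet_inj x y : 0 <= x < 2 -> 0 <= y < 2 ->
  iet sigma (lengths 0) x = iet sigma (lengths 0) y -> x = y.
Proof.
move=> /(cuts_cover a b 0)[i i7 Hx] /(cuts_cover a b 0)[j j7 Hy].
apply: (@iet_inj_piece _ _ _ _ (Ordinal i7) (Ordinal j7)).
- by move=> k; apply: lengths_ge0; exact: norm0_pow3.
- by rewrite left_end_lengths mxE addrC subrK.
- by rewrite left_end_lengths mxE addrC subrK.
Qed.

Lemma uniquely_ergodic_lengths : uniquely_ergodic sigma (lengths 0).
Proof.
have HT := translates_iet (norm0_pow3 ab).
rewrite /uniquely_ergodic /iet_dom total_lengths; split.
  exact: (lebesgue_invariant ab HT).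
move=> mu mu_inv; exact: (finite_invariant_lebesgue ab HT iet_inj mu_inv).
Qed.

Lemma self_similar_lengths : self_similar sigma (lengths 0).
Proof.
have HT := translates_iet (norm0_pow3 ab); have bp := tribonacci_gt0 ab.
have [_ b3 _ _ [_ a2]] := tribonacci_ineq ab.
exists b, (a - b); rewrite /iet_dom total_lengths; split.
- by apply/andP; split=> //; lra.
- split=> [x /=|]; rewrite ?in_itv /=.
    by have := base_end ab; move=> ? /andP[? ?]; apply/andP; split; lra.
  move=> /(_ 0); rewrite /= !in_itv /= lexx ltr0n => /(_ isT) /andP[+ _].
  by apply/negP; rewrite -ltNge; lra.
move=> x /=; rewrite in_itv /= => /andP[x1 x2].
rewrite ietZ //; pose y := (x - (a - b)) / b; rewrite -/y.
have Ex : x = a - b + b * y by rewrite /y mulrC divfK ?gt_eqF // addrC subrK.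
have Hy : 0 <= y < 2.
  by rewrite divr_ge0 ?subr_ge0 ?(ltW bp) //= ltr_pdivrMr // ltrBlDl (mulrC 2).
have d0 : `|b * 0| <= 2 * b - a by exact: norm_times_b (norm0_pow3 ab).
have HT' : translates (cuts a b (b * 0)) (shifts a b (b * 0)) (iet sigma (lengths 0)).
  by rewrite mulr0.
have [n [n0 nE nJ]] := first_return_base ab d0 HT' HT Hy.
exists n; rewrite Ex; split=> //.
  have /andP[T0 T2] := translates_dom ab (norm0_pow3 ab) HT Hy.
  by rewrite /= in_itv /= lerDl mulr_ge0 ?(ltW bp) //= ltrD2l ltr_pM2l.
by move=> m Hm; rewrite /= in_itv /= (mulrC b 2); apply/negP; exact: nJ.
Qed.

Lemma periodic_lengths d : d != 0 -> `|d| <= 1 - a - b -> periodic_iet sigma (lengths d).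
Proof.
move=> d0 d3 x; rewrite /iet_dom total_lengths /= in_itv /=.
exact: (periodic_family ab (T_ := fun d => iet sigma (lengths d)) translates_iet).
Qed.

Lemma lengths_gt0 d : `|d| <= 1 / 16 -> positive_vector (lengths d).
Proof.
rewrite ler_norml => /andP[d1 d2] i; rewrite mxE cutsE.
have [b4 b3 _ ab' [a1 a2]] := tribonacci_ineq ab.
move: i => [[|[|[|[|[|[|[|//]]]]]]] i7] /=; lra.
Qed.

(** The lengths are affine in the parameter. *)
Lemma segment_lengths e t :
  (1 - t) *: lengths (- e) + t *: lengths e = lengths ((2 * t - 1) * e).
Proof.
apply/rowP => i; rewrite !mxE !cutsE.
move: i => [[|[|[|[|[|[|[|//]]]]]]] i7] /=; by ring.
Qed.

End FamilyExchange.

(** The intermediate value theorem on [0.5434, 0.544], an interval small enough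
    for the bounds on a^2. *)
Lemma tribonacci_exists (R : realType) : exists a b : R, tribonacci a b.
Proof.
pose p : {poly R} := 'X ^+ 3 + 'X ^+ 2 + 'X - 1.
have pE x : p.[x] = x ^+ 3 + x ^+ 2 + x - 1 by rewrite !hornerE.
have [||a] := @poly_ivt _ p (2717 / 5000) (544 / 1000).
- lra.
- by rewrite !pE; apply/andP; split; lra.
move=> /andP[a1 a2] /rootP; rewrite pE => Ha.
exists a, (a ^+ 2); rewrite /tribonacci /=; split.
- by rewrite -[RHS]addr0 -Ha; ring.
- by rewrite -[RHS]addr0 -(mul0r (a - 1)) -Ha; ring.
- apply/andP; split; lra.
- by apply/andP; split; nra.
Qed.

Theorem corollary1p2 (R : realType) :
  exists (d : nat) (s : 'S_d) (a0 p q : 'rV[R]_d),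
    [/\ p != q,
        segment p q `<=` positive_vector (d := d),
        open_segment p q a0,
        uniquely_ergodic s a0 /\ self_similar s a0
      & forall a : 'rV[R]_d, segment p q a -> a <> a0 -> periodic_iet s a].
Proof.
have [a [b ab]] := tribonacci_exists R.
(* Every length at d = 0 exceeds 1 / 16. *)
exists 7%N, sigma, (lengths a b 0), (lengths a b (- (1 / 16))), (lengths a b (1 / 16)).
have small t : 0 <= t <= 1 -> `|(2 * t - 1) * (1 / 16) : R| <= 1 / 16.
  by move=> /andP[t0 t1]; rewrite ler_norml; apply/andP; split; lra.
split.
- apply/eqP => /matrixP/(_ 0 0); rewrite !mxE !cutsE /=; lra.
- move=> _ [t + <-]; rewrite /= in_itv /= => t01; rewrite segment_lengths.
  exact: (lengths_gt0 ab (small t t01)).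
- exists (1 / 2); first by rewrite /= in_itv /=; apply/andP; split; lra.
  by rewrite segment_lengths; congr lengths; lra.
- by split; [exact: uniquely_ergodic_lengths|exact: self_similar_lengths].
move=> _ [t + <-]; rewrite /= in_itv /= segment_lengths => /small t16 ne.
apply: (periodic_lengths ab).
  by apply/eqP => E; apply: ne; rewrite E.
have [b4 b3 _ ab' [a1 a2]] := tribonacci_ineq ab.
by apply: (le_trans t16); lra.
Qed.
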